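(* Let $p,q\ge 0$ be integers with $n=p+q\ge 1$. Consider the subsets (Lie groups) of $\mathbb{C}\otimes C\!\ell_{p,q}$ \[ G^{2i1}_{p,q}=\{U\in C\!\ell^{(0)}_{p,q}\oplus iC\!\ell^{(1)}_{p,q}: U^\ddagger U=e\},\quad G^{2i3}_{p,q}=\{U\in C\!\ell^{(0)}_{p,q}\oplus iC\!\ell^{(1)}_{p,q}: \hat U^{\ddagger} U=e\}, \] \[ G^{23}_{p,q}=\{U\in C\!\ell_{p,q}: \tilde U U=e\},\quad G^{12}_{p,q}=\{U\in C\!\ell_{p,q}: \tilde{\hat U} U=e\},\quad G^{2}_{p,q}=\{U\in C\!\ell^{(0)}_{p,q}: \tilde U U=e\}. \] Then the following Lie group isomorphisms hold. (i) If $p-q\equiv 3$ or $7 \pmod 8$ (so $n$ is odd): $G^{23}_{p,q}\cong \mathrm{U}(2^{\frac{n-1}{2}})$ if $(p,q)=(n,0)$; $G^{23}_{p,q}\cong \mathrm{U}(2^{\frac{n-3}{2}},2^{\frac{n-3}{2}})$ if $n\equiv 3,7\pmod 8$ and $q\ne 0$; $G^{23}_{p,q}\cong \mathrm{Sp}(2^{\frac{n-3}{2}},\mathbb{C})$ if $n\equiv 5\pmod 8$; $G^{23}_{p,q}\cong \mathrm{O}(2^{\frac{n-1}{2}},\mathbb{C})$ if $n\equiv 1\pmod 8$. (ii) If $p-q\equiv 3$ or $7\pmod 8$: $G^{12}_{p,q}\cong \mathrm{U}(2^{\frac{n-1}{2}})$ if $(p,q)=(0,n)$; $G^{12}_{p,q}\cong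 \mathrm{U}(2^{\frac{n-3}{2}},2^{\frac{n-3}{2}})$ if $n\equiv 1,5\pmod 8$ and $p\ne 0$; $G^{12}_{p,q}\cong \mathrm{Sp}(2^{\frac{n-3}{2}},\mathbb{C})$ if $n\equiv 3\pmod 8$; $G^{12}_{p,q}\cong \mathrm{O}(2^{\frac{n-1}{2}},\mathbb{C})$ if $n\equiv 7\pmod 8$. (iii) If $p-q\equiv 1$ or $5\pmod 8$ (so $n$ is odd): $G^{2i1}_{p,q}\cong \mathrm{U}(2^{\frac{n-1}{2}})$ if $(p,q)=(n,0)$; $G^{2i1}_{p,q}\cong \mathrm{U}(2^{\frac{n-3}{2}},2^{\frac{n-3}{2}})$ if $n\equiv 1,5\pmod 8$ and $q\ne 0$; $G^{2i1}_{p,q}\cong \mathrm{Sp}(2^{\frac{n-3}{2}},\mathbb{C})$ if $n\equiv 3\pmod 8$; $G^{2i1}_{p,q}\cong \mathrm{O}(2^{\frac{n-1}{2}},\mathbb{C})$ if $n\equiv 7\pmod 8$. (iv) If $p-q\equiv 1$ or $5\pmod 8$: $G^{2i3}_{p,q}\cong \mathrm{U}(2^{\frac{n-1}{2}})$ if $(p,q)=(0,n)$; $G^{2i3}_{p,q}\cong \mathrm{U}(2^{\frac{n-3}{2}},2^{\frac{n-3}{2}})$ if $n\equiv 3,7\pmod 8$ and $p\ne 0$; $G^{2i3}_{p,q}\cong \mathrm{Sp}(2^{\frac{n-3}{2}},\mathbb{C})$ if $n\equiv 5\pmod 8$; $G^{2i3}_{p,q}\cong \mathrm{O}(2^{\frac{n-1}{2}},\mathbb{C})$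 if $n\equiv 1\pmod 8$. (v) If $p-q\equiv 2$ or $6\pmod 8$ (so $n$ is even): $G^{2}_{p,q}\cong \mathrm{U}(2^{\frac{n-2}{2}})$ if $(p,q)=(n,0)$ or $(p,q)=(0,n)$; $G^{2}_{p,q}\cong \mathrm{U}(2^{\frac{n-4}{2}},2^{\frac{n-4}{2}})$ if $n\equiv 2,6\pmod 8$ and $p,q\ne 0$; $G^{2}_{p,q}\cong \mathrm{Sp}(2^{\frac{n-4}{2}},\mathbb{C})$ if $n\equiv 4\pmod 8$; $G^{2}_{p,q}\cong \mathrm{O}(2^{\frac{n-2}{2}},\mathbb{C})$ if $n\equiv 0\pmod 8$.
   Context: $C\!\ell_{p,q}$ is the real Clifford algebra with identity $e$ and generators $e^1,\dots,e^n$ ($n=p+q$) satisfying $e^ae^b+e^be^a=2\eta^{ab}e$, where $\eta=\mathrm{diag}(1,\dots,1,-1,\dots,-1)$ with $p$ entries $+1$ and $q$ entries $-1$; the elements $e$ and $e^{a_1\dots a_k}=e^{a_1}\cdots e^{a_k}$ ($a_1<\dots<a_k$) form a basis. $\mathbb{C}\otimes C\!\ell_{p,q}$ is its complexification (same basis, complex coefficients). $C\!\ell^k_{p,q}$ is the span of basis elements of grade $k$; $C\!\ell^{(0)}_{p,q}=\bigoplus_{k \text{ even}}C\!\ell^k_{p,q}$, $C\!\ell^{(1)}_{p,q}=\bigoplus_{k\text{ odd}}C\!\ell^k_{p,q}$. The grade involution $U\mapsto \hat U$ replaces each $e^a$ by $-e^a$; the reversion $U\mapsto\tilde U$ is the linear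 map sending $e^{a_1\dots a_r}$ to $e^{a_r}\cdots e^{a_1}$; complex conjugation $U\mapsto \bar U$ conjugates all complex coefficients in the basis expansion; $U^\ddagger=\tilde{\bar U}$ (pseudo-Hermitian conjugation). Classical groups: $\mathrm{U}(m)=\{A\in\mathrm{Mat}(m,\mathbb{C}):A^\dagger A=\mathbf 1\}$; $\mathrm{U}(r,s)=\{A\in \mathrm{Mat}(r+s,\mathbb{C}):A^\dagger\eta_{r,s}A=\eta_{r,s}\}$ with $\eta_{r,s}=\mathrm{diag}(1,\dots,1,-1,\dots,-1)$ ($r$ ones, $s$ minus ones); $\mathrm{Sp}(m,\mathbb{C})=\{A\in\mathrm{Mat}(2m,\mathbb{C}):A^T\Omega A=\Omega\}$ with $\Omega=\begin{pmatrix}0&-\mathbf 1\\ \mathbf 1&0\end{pmatrix}$; $\mathrm{O}(m,\mathbb{C})=\{A\in \mathrm{Mat}(m,\mathbb{C}):A^TA=\mathbf 1\}$. *)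

(* Defs.v *)
(* Complex numbers are R[i] = complex R (mathcomp-real-closed)
   over an arbitrary realType R (every realType is isomorphic to the reals). *)
From HB Require Import structures.
From mathcomp Require Import all_boot all_order all_algebra.
From mathcomp Require Import reals.
From mathcomp Require Import complex.
Set Implicit Arguments. Unset Strict Implicit. Unset Printing Implicit Defensive.
Import Order.TTheory GRing.Theory Num.Theory.
Local Open Scope ring_scope.

Section Clifford.
Variable R : realType.
Local Notation C := (R[i]).

(* An element of C (x) Cl_{p,q} (n = p+q) is its family of complex coefficients
   on the basis blades e^A, A a subset of {0,...,n-1}
   (e^A = e^{a_1} ... e^{a_k}, a_1 < ... < a_k; e^{emptyset} = e). *)
Definition cl (n : nat) := {ffun {set 'I_n} -> C}.

Definition eta (p n : nat) (a : 'I_n) : C := if (a < p)%N then 1 else -1.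

(* e^A e^B = (-1)^{#{(a,b) in A x B : b < a}} (prod_{c in A /\ B} eta^{cc}) e^{A (sym. diff.) B} *)
Definition blade_coef (p n : nat) (A B : {set 'I_n}) : C :=
  (-1) ^+ #|[set ab : 'I_n * 'I_n | [&& ab.1 \in A, ab.2 \in B & (ab.2 < ab.1)%N]]|
  * \prod_(c in A :&: B) eta p c.

Definition symd (n : nat) (A B : {set 'I_n}) : {set 'I_n} := (A :\: B) :|: (B :\: A).

Definition clmul (p q : nat) (U V : cl (p + q)) : cl (p + q) :=
  [ffun D => \sum_(A : {set 'I_(p + q)}) \sum_(B : {set 'I_(p + q)})
              (if symd A B == D then U A * V B * blade_coef p A B else 0)].

Definition clone (n : nat) : cl n := [ffun A : {set 'I_n} => if A == set0 then 1 else 0].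

Definition clhat (n : nat) (U : cl n) : cl n := [ffun A : {set 'I_n} => (-1) ^+ #|A| * U A].
(* reversion: e^{a_1...a_r} |-> e^{a_r}...e^{a_1} = (-1)^{r(r-1)/2} e^{a_1...a_r} *)
Definition clrev (n : nat) (U : cl n) : cl n := [ffun A : {set 'I_n} => (-1) ^+ 'C(#|A|, 2) * U A].
Definition clconj (n : nat) (U : cl n) : cl n := [ffun A : {set 'I_n} => conjc (U A)].
Definition cldag (n : nat) (U : cl n) : cl n := clrev (clconj U).

Definition in_real (n : nat) (U : cl n) : Prop := forall A : {set 'I_n}, Im (U A) = 0.
Definition in_even_iodd (n : nat) (U : cl n) : Prop :=
  forall A : {set 'I_n}, if odd #|A| then Re (U A) = 0 else Im (U A) = 0.
Definition in_even (n : nat) (U : cl n) : Prop :=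
  forall A : {set 'I_n}, Im (U A) = 0 /\ (odd #|A| -> U A = 0).

Definition G2i1 (p q : nat) (U : cl (p + q)) : Prop :=
  in_even_iodd U /\ clmul (cldag U) U = clone (p + q).
Definition G2i3 (p q : nat) (U : cl (p + q)) : Prop :=
  in_even_iodd U /\ clmul (cldag (clhat U)) U = clone (p + q).
Definition G23 (p q : nat) (U : cl (p + q)) : Prop :=
  in_real U /\ clmul (clrev U) U = clone (p + q).
Definition G12 (p q : nat) (U : cl (p + q)) : Prop :=
  in_real U /\ clmul (clrev (clhat U)) U = clone (p + q).
Definition G2 (p q : nat) (U : cl (p + q)) : Prop :=
  in_even U /\ clmul (clrev U) U = clone (p + q).

Definition mxdag (m : nat) (A : 'M[C]_m) : 'M[C]_m := (map_mx conjc A)^T.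

Definition Ugrp (m : nat) (A : 'M[C]_m) : Prop := mxdag A *m A = 1%:M.
Definition eta_rs (r s : nat) : 'M[C]_(r + s) := block_mx 1%:M 0 0 (- 1%:M).
Definition Upq (r s : nat) (A : 'M[C]_(r + s)) : Prop :=
  mxdag A *m eta_rs r s *m A = eta_rs r s.
Definition Omega (m : nat) : 'M[C]_(m + m) := block_mx 0 (- 1%:M) 1%:M 0.
Definition SpC (m : nat) (A : 'M[C]_(m + m)) : Prop := A^T *m Omega m *m A = Omega m.
Definition OC (m : nat) (A : 'M[C]_m) : Prop := A^T *m A = 1%:M.

(* Euclidean topology on the finite-dimensional complex spaces, via the
   (equivalent) sum-of-moduli norms on coordinates *)
Definition cl_dist (n : nat) (U V : cl n) : R :=
  \sum_(A : {set 'I_n}) Normc.normc (U A - V A).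
Definition mx_dist (m : nat) (A B : 'M[C]_m) : R :=
  \sum_(i < m) \sum_(j < m) Normc.normc (A i j - B i j).

Definition cont_on {X Y : Type} (dX : X -> X -> R) (dY : Y -> Y -> R)
    (P : X -> Prop) (f : X -> Y) : Prop :=
  forall x, P x -> forall e : R, 0 < e -> exists2 d : R, 0 < d &
    forall y, P y -> dX x y < d -> dY (f x) (f y) < e.

(* Isomorphism of topological groups between G (subset of C (x) Cl_{p,q},
   with the Clifford product) and a matrix group H (with the matrix product):
   a bijection G -> H which is a group homomorphism and a homeomorphism.
   (For Lie groups this is the same as a Lie group isomorphism, since
   continuous homomorphisms of Lie groups are smooth.) *)
Definition lie_iso (p q m : nat) (G : cl (p + q) -> Prop) (H : 'M[C]_m -> Prop) : Prop :=
  exists (f : cl (p + q) -> 'M[C]_m) (g : 'M[C]_m -> cl (p + q)),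
    (forall U, G U -> H (f U)) /\
    (forall X, H X -> G (g X)) /\
    (forall U, G U -> g (f U) = U) /\
    (forall X, H X -> f (g X) = X) /\
    (forall U V, G U -> G V -> f (clmul U V) = f U *m f V) /\
    cont_on (@cl_dist (p + q)) (@mx_dist m) G f /\
    cont_on (@mx_dist m) (@cl_dist (p + q)) H g.

End Clifford.

(* Main.v *)
(** Let [n = 2k+1] and let [gamma_0, ..., gamma_2k] be Kronecker products of Pauli
    matrices, of size [N = 2^k].  Sending [e^a] to [gamma_a] or [i gamma_a] represents
    the complexified algebra on [C^N], and the condition on [p - q] says exactly
    that the pseudoscalar of the relevant real form is sent to an imaginary scalar.
    Hence [Re (tr (E_A^-1 X)) / N] recovers the coordinates of an element of the real
    form, so the representation is injective on it, and it is onto [Mat(N, C)] because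
    the real dimensions agree.  The defining involution becomes [X |-> J^-1 X^* J], where
    [X^*] is either the adjoint and [J] is the product of the gammas of negative
    square, or the transpose and [J] is the product of the antisymmetric gammas.
    For the even subalgebra with [n = 2k+2] the last generator is sent to a scalar.

    It remains to bring [J] to normal form by congruence.  If [X] and [Y] are
    anticommuting involutions, [P = X + Y] satisfies [P Y P = 2 X]; if they commute,
    [Q = X Y + i] satisfies [Q Y Q = 2 i X].  As the gammas (anti)commute with [J], such
    steps carry [J] to [1], to the last gamma, which is [eta], or to the last but one,
    which is [i Omega]. *)
Require Import Defs.
From HB Require Import structures.
From mathcomp Require Import all_boot all_order all_algebra.
From mathcomp Require Import reals.
From mathcomp Require Import complex.
From mathcomp Require Import ring zify.
Set Implicit Arguments. Unset Strict Implicit. Unset Printing Implicit Defensive.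
Import Order.TTheory GRing.Theory Num.Theory.
Local Open Scope ring_scope.

(** * Ordered products of anticommuting matrices *)

(** Sets of generators are Boolean functions on [nat], read below [m]: induction on [m] then removes
    the last generator without any change of type. *)
Fixpoint cnt (c : nat -> bool) (m : nat) : nat :=
  if m is m'.+1 then (cnt c m' + c m')%N else 0%N.

Lemma cnt_sum c m : cnt c m = (\sum_(i < m) c i)%N.
Proof. by elim: m => [|m IH]; rewrite ?big_ord0 // big_ord_recr /= IH. Qed.

Lemma eq_cnt c d m : (forall i, (i < m)%N -> c i = d i) -> cnt c m = cnt d m.
Proof. by move=> e; rewrite !cnt_sum; apply: eq_bigr => i _; rewrite e. Qed.

Lemma cnt_predT m : cnt xpredT m = m.
Proof. by elim: m => //= m ->; rewrite addn1. Qed.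

Lemma cnt_le c m : (cnt c m <= m)%N.
Proof.
elim: m => //= m IH; rewrite -addn1; apply: leq_add => //; exact: leq_b1.
Qed.

Lemma cnt_eq0 c m : cnt c m = 0%N -> forall i, (i < m)%N -> c i = false.
Proof.
elim: m => //= m IH /eqP; rewrite addn_eq0 => /andP[/eqP /IH h].
rewrite eqb0 => /negbTE cm i; rewrite ltnS leq_eqVlt => /orP[/eqP->//|/h//].
Qed.

Lemma cnt_full c m : cnt c m = m -> forall i, (i < m)%N -> c i.
Proof.
elim: m => //= m IH; have := cnt_le c m; case cm: (c m).
  rewrite addn1 => _ [/IH h] i; rewrite ltnS leq_eqVlt => /orP[/eqP->//|/h//].
by rewrite addn0 => le e; rewrite e ltnn in le.
Qed.

Lemma cntD1 c a m :
  (cnt (fun i => c i && (i != a)) m + (c a && (a < m)%N))%N = cnt c m.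
Proof.
elim: m => [|m IH] /=; first by rewrite ltn0 andbF.
rewrite -IH ltnS; have [<-|am] := eqVneq m a.
  by rewrite leqnn ltnn !andbF !andbT !addn0.
by rewrite andbT leq_eqVlt eq_sym (negbTE am) /= addnAC.
Qed.

Lemma odd_cnt_addb c d m :
  odd (cnt (fun i => c i (+) d i) m) = odd (cnt c m) (+) odd (cnt d m).
Proof.
elim: m => [//|m IH] /=; rewrite oddD oddb IH oddD oddb oddD oddb.
by case: (odd (cnt c m)) (odd (cnt d m)) (c m) (d m) => [] [] [] [].
Qed.

(** The parity is that of the number of factors of the blade [c] other than [a], so it says that
    generator [a] anticommutes with this blade. Take [a] outside a set of odd size and inside a set
    of even size. *)
Lemma exists_anticomm c m : (0 < cnt c m < m)%N ->
  exists2 a, (a < m)%N & odd (cnt c m) (+) c a.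
Proof.
move=> /andP[c0 cm]; case: (boolP (odd (cnt c m))) => o.
  have [i ni|h] := pickP (fun i : 'I_m => ~~ c i); first by exists i.
  move: cm; rewrite (@eq_cnt c xpredT m) ?cnt_predT ?ltnn // => i im.
  by have /negbFE := h (Ordinal im).
have [i ni|h] := pickP (fun i : 'I_m => c i); first by exists i.
move: c0; rewrite (@eq_cnt c (fun=> false) m); last by move=> i im; exact: (h (Ordinal im)).
by rewrite cnt_sum big1.
Qed.

Section Blades.
Variable F : fieldType.
Variable N : nat.
Implicit Types (E : nat -> 'M[F]_N) (h : nat -> F) (c d : nat -> bool).

Fixpoint blade E c (m : nat) : 'M[F]_N :=
  if m is m'.+1 then blade E c m' *m (if c m' then E m' else 1%:M) else 1%:M.

(* The coefficient [blade_coef], for the characteristic functions of the two subsets. *)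
Fixpoint bcoef h c d (m : nat) : F :=
  if m is m'.+1 then
    bcoef h c d m' * ((-1) ^+ (c m' * cnt d m') * (if c m' && d m' then h m' else 1))
  else 1.

Lemma eq_blade E E' c d m : (forall i, (i < m)%N -> E i = E' i) ->
  (forall i, (i < m)%N -> c i = d i) -> blade E c m = blade E' d m.
Proof.
elim: m => //= m IH eE ec; rewrite IH ?eE ?ec // => i im; [apply: eE|apply: ec];
exact: ltnW.
Qed.

Lemma blade_pred0 E c m : (forall i, (i < m)%N -> c i = false) ->
  blade E c m = 1%:M.
Proof.
elim: m => //= m IH ec; rewrite ec // mulmx1 IH // => i im; apply: ec; exact: ltnW.
Qed.

Definition anticomm E m := forall i j, (i < m)%N -> (j < m)%N -> i <> j ->
  E i *m E j = - (E j *m E i).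

Lemma anticommS E m : anticomm E m.+1 -> anticomm E m.
Proof. by move=> h i j im jm; apply: h; apply: ltnW. Qed.

Lemma blade_commE E c a m :
  (forall i, (i < m)%N -> i <> a -> E a *m E i = - (E i *m E a)) ->
  E a *m blade E c m =
  (-1) ^+ cnt (fun i => c i && (i != a)) m *: (blade E c m *m E a).
Proof.
elim: m => [|m IH] h /=; first by rewrite mulmx1 mul1mx expr0 scale1r.
rewrite mulmxA IH => [|i im]; last by apply: h; apply: ltnW.
case: (c m) => /=; last by rewrite !mulmx1 addn0.
rewrite -scalemxAl -[_ *m E a *m E m]mulmxA.
have [->|/eqP ma] := eqVneq m a; first by rewrite addn0 mulmxA.
by rewrite h // exprD expr1 mulrN1 mulmxN scalerN scaleNr mulmxA.
Qed.

(** The last generator of the left factor is moved across the right blade, which costs [cnt d m]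
    signs; if both factors contain it, the two copies merge into [h m]. *)
Lemma blade_mul E h c d m :
  anticomm E m -> (forall i, (i < m)%N -> E i *m E i = (h i)%:M) ->
  blade E c m *m blade E d m = bcoef h c d m *: blade E (fun i => c i (+) d i) m.
Proof.
elim: m => [|m IH] ac sq /=; first by rewrite mulmx1 scale1r.
have {}IH := IH (anticommS ac) (fun i im => sq i (ltnW im)).
have -> : blade E c m *m (if c m then E m else 1%:M)
    *m (blade E d m *m (if d m then E m else 1%:M))
  = (-1) ^+ (c m * cnt d m) *: (blade E c m *m blade E d m *m
     ((if c m then E m else 1%:M) *m (if d m then E m else 1%:M))).
  case: (c m); last by rewrite mul0n expr0 scale1r mulmx1 mul1mx mulmxA.
  rewrite mul1n -!mulmxA [E m *m (blade _ _ _ *m _)]mulmxA blade_commE => [|i im /eqP ma].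
    rewrite -scalemxAl -scalemxAr !mulmxA; congr (_ ^+ _ *: _).
    by apply: eq_cnt => i im; rewrite ltn_eqF ?andbT.
  by apply: ac => //; [apply: ltnW|move=> e; rewrite e eqxx in ma].
rewrite IH -scalemxAl scalerA mulrA [bcoef _ _ _ _ * _]mulrC -[RHS]scalerA.
congr (_ *: _).
by case: (c m); case: (d m) => /=;
  rewrite ?mul1mx ?mulmx1 ?scale1r // sq // mul_mx_scalar.
Qed.

(** This treats both involutions at once: the adjoint for [f = conjc] and the transpose for
    [f = idfun]. *)
Definition star (f : {rmorphism F -> F}) n (A : 'M[F]_n) : 'M[F]_n := (map_mx f A)^T.

Lemma starM f n (A B : 'M[F]_n) : star f (A *m B) = star f B *m star f A.
Proof. by rewrite /star map_mxM trmx_mul. Qed.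

Lemma star1 f n : star f (1%:M : 'M[F]_n) = 1%:M.
Proof. by rewrite /star map_mx1 trmx1. Qed.

Lemma starZ f n a (A : 'M[F]_n) : star f (a *: A) = f a *: star f A.
Proof. by rewrite /star map_mxZ linearZ. Qed.

(** [star] reverses the product: each of the [r] factors contributes [s], and restoring the order
    costs ['C(r, 2)] signs, exactly as in [clrev]. *)
Lemma blade_star (f : {rmorphism F -> F}) E c J s m : anticomm E m ->
  (forall i, (i < m)%N -> c i -> star f (E i) *m J = s *: (J *m E i)) ->
  star f (blade E c m) *m J =
  (s ^+ cnt c m * (-1) ^+ 'C(cnt c m, 2)) *: (J *m blade E c m).
Proof.
elim: m => [|m IH] ac hs /=.
  by rewrite star1 mul1mx mulmx1 expr0 mul1r bin0n expr0 scale1r.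
have {}IH := IH (anticommS ac) (fun i im => hs i (ltnW im)).
rewrite starM -mulmxA IH -scalemxAr !mulmxA.
case cm: (c m) => /=; last by rewrite star1 mul1mx mulmx1 addn0.
rewrite hs // -scalemxAl -[J *m E m *m _]mulmxA blade_commE => [|i im /eqP ma]; last first.
  by apply: ac => //; [apply: ltnW|move=> e; rewrite e eqxx in ma].
rewrite (@eq_cnt _ c) => [|i im]; last by rewrite ltn_eqF ?andbT.
rewrite addn1 binS bin1 -scalemxAr !scalerA mulmxA exprS exprD; congr (_ *: _).
by rewrite -!mulrA [RHS]mulrCA; congr (_ * _); rewrite mulrCA.
Qed.

End Blades.

(** * Gamma matrices: signs, transposes and the pseudoscalar *)

Section Gamma.
Variable R : realType.
Local Notation C := R[i].
Local Notation ii := ('i%C : C).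

(** Defined by doubling, so that [gdim k.+1] is convertible to the size of a block matrix with
    blocks of size [gdim k]. *)
Fixpoint gdim (k : nat) : nat := if k is k'.+1 then (gdim k' + gdim k')%N else 1%N.

Lemma gdimE k : gdim k = (2 ^ k)%N.
Proof. by elim: k => //= k ->; rewrite addnn -mul2n expnS. Qed.

Lemma gdim_gt0 k : (0 < gdim k)%N.
Proof. by rewrite gdimE expn_gt0. Qed.

(* In Kronecker notation: sigma_1 (x) gamma_a, then sigma_2 (x) 1, then sigma_3 (x) 1. *)
Fixpoint gamma (k a : nat) : 'M[C]_(gdim k) :=
  match k return 'M[C]_(gdim k) with
  | 0 => 1%:M
  | k'.+1 => if (a < k'.*2.+1)%N then block_mx 0 (gamma k' a) (gamma k' a) 0
             else if a == k'.*2.+1 then block_mx 0 (- ii)%:M ii%:M 0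
             else block_mx 1%:M 0 0 (- 1%:M)
  end.

Lemma conjci : conjc ii = - ii.
Proof. by apply/eqP; rewrite eq_complex /= oppr0 !eqxx. Qed.

Lemma mulii : ii * ii = -1.
Proof. by rewrite -expr2 sqr_i. Qed.

Lemma gamma_sqr k a : gamma k a *m gamma k a = 1%:M.
Proof.
elim: k => [|k IH] /=; first by rewrite mulmx1.
case: ifP => _; [|case: ifP => _]; rewrite mulmx_block !mul0mx !mulmx0 !add0r ?addr0 ?IH.
- by rewrite scalar_mx_block.
- by rewrite -!scalar_mxM mulNr mulrN mulii opprK scalar_mx_block.
- by rewrite mulmxN mulNmx opprK mulmx1 scalar_mx_block.
Qed.

Lemma gamma_anticomm k : anticomm (gamma k) k.*2.+1.
Proof.
elim: k => [[|//] [|//]//|k IH].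
have key i j : (i < j)%N -> (j < k.*2.+3)%N ->
    gamma k.+1 i *m gamma k.+1 j = - (gamma k.+1 j *m gamma k.+1 i).
  move=> ij jk /=.
  case: (ltnP j k.*2.+1) => [jl|jl].
    have ne : i <> j by move=> e; rewrite e ltnn in ij.
    rewrite (ltn_trans ij jl) !mulmx_block !mul0mx !mulmx0 !add0r !addr0.
    by rewrite opp_block_mx !oppr0 (IH i j) ?(ltn_trans ij jl).
  case: (eqVneq j k.*2.+1) => [jE|jE].
    rewrite -jE ij !mulmx_block !mul0mx !mulmx0 !add0r !addr0.
    by rewrite opp_block_mx !oppr0 !mul_mx_scalar !mul_scalar_mx !scaleNr opprK.
  have {jl jE}jE : j = k.*2.+2.
    by apply/eqP; rewrite eqn_leq -ltnS jk ltn_neqAle eq_sym jE jl.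
  rewrite jE ltnS in ij; case: (ltnP i k.*2.+1) => il; last first.
    have -> : i = k.*2.+1 by apply/eqP; rewrite eqn_leq ij.
    rewrite eqxx !mulmx_block !mul0mx !mulmx0 !add0r !addr0.
    by rewrite opp_block_mx !oppr0 !mulmxN !mulNmx !mulmx1 !mul1mx opprK.
  rewrite !mulmx_block !mul0mx !mulmx0 !add0r !addr0.
  by rewrite opp_block_mx !oppr0 !mulmxN !mulNmx !mulmx1 !mul1mx opprK.
move=> i j ik jk ne; case: (ltngtP i j) => [ij|ji|//]; first exact: key.
by rewrite (key j i) // opprK.
Qed.

Lemma gamma_herm k a : star conjc (gamma k a) = gamma k a.
Proof.
elim: k => [|k IH] /=; first exact: star1.
case: ifP => _; [|case: ifP => _]; rewrite /star map_block_mx tr_block_mx.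
- by rewrite !map_mx0 !trmx0 -/(star _ _) IH.
- rewrite !map_mx0 !trmx0 !map_scalar_mx !tr_scalar_mx.
  by congr (block_mx _ _%:M _%:M _); apply/eqP; rewrite eq_complex /= ?oppr0 ?opprK !eqxx.
- by rewrite !map_mx0 !trmx0 map_mxN /= !map_mx1 linearN /= !trmx1.
Qed.

(** Of the Pauli matrices only [sigma_2] is antisymmetric, and each level places it at the odd index
    [k.*2.+1]. *)
Lemma gamma_tr k a : (a < k.*2.+1)%N -> (gamma k a)^T = (-1) ^+ a *: gamma k a.
Proof.
elim: k => [|k IH] /=; first by case: a => // _; rewrite trmx1 expr0 scale1r.
move=> ak; case: ifP => al; [|case: ifP => aE]; rewrite tr_block_mx scale_block_mx.
- by rewrite !trmx0 !scaler0 IH.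
- rewrite (eqP aE) exprS -signr_odd odd_double expr0 mulr1 !scaleN1r !oppr0 !trmx0.
  by rewrite !tr_scalar_mx !raddfN /= !opprK.
- have -> : a = k.*2.+2.
    by apply/eqP; rewrite eqn_leq -ltnS ak ltn_neqAle eq_sym aE leqNgt al.
  rewrite -signr_odd /= negbK odd_double expr0 !scale1r !trmx0 trmx1.
  by rewrite linearN /= trmx1.
Qed.

(** The factors are [sigma_1 (x) gamma_a], so the product is a power of [sigma_1] tensored with the
    smaller blade, and [sigma_1] squares to one. *)
Lemma gammaS_blade k c m : (m <= k.*2.+1)%N ->
  blade (gamma k.+1) c m = let b := blade (gamma k) c m in
    if odd (cnt c m) then block_mx 0 b b 0 else block_mx b 0 0 b.
Proof.
elim: m => [|m IH] mk; first by rewrite /= scalar_mx_block.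
rewrite [LHS]/= mk IH ?(ltnW mk) // /= oddD; case: (c m) => /=; last first.
  by rewrite addbF !mulmx1.
by case: (odd _); rewrite mulmx_block !mul0mx !mulmx0 !add0r ?addr0.
Qed.

(** Each level contributes one factor [i], because [sigma_1 sigma_2 sigma_3 = i]. *)
Lemma gamma_full k : blade (gamma k) xpredT k.*2.+1 = (ii ^+ k)%:M.
Proof.
elim: k => [|k IH]; first by rewrite /= mulmx1.
have -> : blade (gamma k.+1) xpredT k.+1.*2.+1 =
  blade (gamma k.+1) xpredT k.*2.+1 *m gamma k.+1 k.*2.+1 *m gamma k.+1 k.*2.+2 by [].
rewrite gammaS_blade // cnt_predT oddS odd_double IH.
rewrite /= ltnn eqxx ltnNge leqnSn /= eqn_leq ltnn /=.
rewrite mulmx_block !mul0mx !mulmx0 !add0r !addr0.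
rewrite mulmx_block !mul0mx.
rewrite !mulmx0 !add0r addr0 !mulmxN !mulmx1 -!scalar_mxM.
by rewrite mulrN raddfN /= opprK -scalar_mx_block -exprSr.
Qed.

Lemma gamma_last k : gamma k.+1 k.*2.+2 = block_mx 1%:M 0 0 (- 1%:M).
Proof. by rewrite /= ltnNge leqnSn /= eqn_leq ltnn. Qed.

Lemma gamma_penult k : gamma k.+1 k.*2.+1 = ii *: Omega R (gdim k).
Proof.
rewrite /= ltnn eqxx /Omega scale_block_mx !scaler0 scalerN scalemx1.
by rewrite raddfN.
Qed.

End Gamma.

(** * Subsets of the generators and the coefficients of the Clifford product *)

Section BladeCoef.
Variable R : realType.
Local Notation C := R[i].
Variable n : nat.
Implicit Types A B : {set 'I_n}.

Definition ind A (i : nat) : bool := [exists a : 'I_n, (a \in A) && (val a == i)].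

Lemma ind_ord A (a : 'I_n) : ind A a = (a \in A).
Proof.
apply/existsP/idP => [[b /andP[bA /eqP/val_inj <-]]//|aA].
by exists a; rewrite aA eqxx.
Qed.

Lemma ind_symd A B i : (i < n)%N -> ind (symd A B) i = ind A i (+) ind B i.
Proof.
move=> im; rewrite !(ind_ord _ (Ordinal im)) !inE.
by case: (_ \in A); case: (_ \in B).
Qed.

Lemma ind0 i : ind set0 i = false.
Proof. by apply/existsP => -[a]; rewrite inE. Qed.

Lemma cnt_ind A : cnt (ind A) n = #|A|.
Proof.
rewrite cnt_sum -sum1_card [RHS]big_mkcond; apply: eq_bigr => a _.
by rewrite ind_ord; case: (a \in A).
Qed.

Lemma bcoef_prod (F : fieldType) h c d m : bcoef h c d m =
  \prod_(i < m) ((-1) ^+ (c i * cnt d i) * (if c i && d i then h i else 1)) :> F.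
Proof. by elim: m => [|m IH] /=; rewrite ?big_ord0 ?big_ord_recr /= ?IH. Qed.

Definition etan p (i : nat) : C := if (i < p)%N then 1 else -1.

(** The inversions between [A] and [B] are counted by grouping the pairs according to their first
    entry. *)
Lemma bcoef_blade_coef p A B :
  bcoef (etan p) (ind A) (ind B) n = blade_coef R p A B.
Proof.
rewrite bcoef_prod big_split /=; congr (_ * _); last first.
  rewrite [RHS]big_mkcond; apply: eq_bigr => a _.
  by rewrite !ind_ord inE /etan /Defs.eta.
rewrite prodrXr; congr (_ ^+ _).
rewrite -sum1_card [RHS]big_mkcond /=; under [RHS]eq_bigr => ab _ do rewrite inE.
rewrite -(pair_bigA _ (fun a b : 'I_n =>
  if [&& a \in A, b \in B & (b < a)%N] then 1%N else 0%N)) /=.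
apply: eq_bigr => a _; rewrite ind_ord cnt_sum.
rewrite (big_ord_widen n (fun i => nat_of_bool (ind B i))) ?(ltnW (ltn_ord a)) //.
rewrite big_mkcond /= big_distrr /=; apply: eq_bigr => b _.
by rewrite ind_ord; case: (a \in A); case: (b \in B); case: (b < a)%N.
Qed.

Lemma blade_coef_real p A B : blade_coef R p A B \is Num.real.
Proof.
have N1 : (-1 : C) \is Num.real by rewrite (realN (1 : C)) real1.
apply: rpredM; first exact: rpredX.
elim/big_ind: _ => [|x y|a _]; [exact: real1|exact: realM|].
by rewrite /Defs.eta; case: (a < p)%N; [exact: real1|exact: N1].
Qed.

Lemma blade_coef_sqr p A B : blade_coef R p A B * blade_coef R p A B = 1.
Proof.
rewrite /blade_coef mulrACA -expr2 sqrr_sign mul1r -big_split /=.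
by rewrite big1 // => a _; rewrite /Defs.eta; case: ifP; rewrite ?mulrNN mulr1.
Qed.

Lemma symdxx A : symd A A = set0.
Proof. by rewrite /symd setDv setU0. Qed.

Lemma symd_eq0 A B : (symd A B == set0) = (A == B).
Proof. by rewrite /symd setU_eq0 !setD_eq0 eqEsubset. Qed.

Lemma odd_card_symd A B : odd #|symd A B| = odd #|A| (+) odd #|B|.
Proof.
by rewrite -!cnt_ind -odd_cnt_addb (@eq_cnt _ (fun i => ind A i (+) ind B i)) //; apply: ind_symd.
Qed.

Lemma card_sets : #|{set 'I_n}| = (2 ^ n)%N.
Proof. by rewrite -cardsT -powersetT card_powerset cardsT card_ord. Qed.

(** Symmetric difference with a fixed singleton exchanges the sets of even and of odd size, so each
    kind is half of all sets. *)
Lemma card_even_sets : (0 < n)%N ->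
  #|[pred A : {set 'I_n} | ~~ odd #|A|]| = (2 ^ n.-1)%N.
Proof.
move=> n0; set P := [pred _ | _]; pose z := [set Ordinal n0].
have inv : involutive (symd z).
  by move=> A; apply/setP=> x; rewrite !inE; case: (_ \in A); case: (_ == _).
have eqc : #|P| = #|predC P|.
  rewrite -(card_image (inv_inj inv) P); apply: eq_card => A; apply/imageP/idP => [[B PB ->]|hA].
    by rewrite !inE odd_card_symd cards1 /= negbK; exact: PB.
  exists (symd z A); rewrite ?inv // !inE odd_card_symd cards1 /= negbK.
  by rewrite !inE negbK in hA.
have := cardC P; rewrite -eqc addnn card_sets -[in (2 ^ n)%N](prednK n0) expnS mul2n.
by move=> /double_inj.
Qed.

End BladeCoef.

(** Equal cardinalities make both families square matrices, for which a right inverse is also a left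
    inverse. *)
Lemma sq_inverse (F : comNzRingType) (S T : finType) (P : pred S)
    (a : S -> T -> F) (b : T -> S -> F) : #|P| = #|T| ->
  (forall A B, P A -> P B -> \sum_t a A t * b t B = (A == B)%:R) ->
  forall t t', \sum_(A | P A) b t A * a A t' = (t == t')%:R.
Proof.
move=> e ab t t'.
pose v (i : 'I_#|T|) : S := enum_val (cast_ord (esym e) i).
have Pv i : P (v i) by exact: enum_valP.
pose M : 'M[F]_#|T| := \matrix_(i, j) a (v i) (enum_val j).
pose K : 'M[F]_#|T| := \matrix_(i, j) b (enum_val i) (v j).
have MK : M *m K = 1%:M.
  apply/matrixP => i j; rewrite !mxE.
  under eq_bigr do rewrite !mxE.
  rewrite -(big_enum_val (fun t => a (v i) t * b t (v j))) ab //.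
  by rewrite (inj_eq enum_val_inj) (inj_eq (@cast_ord_inj _ _ _)).
have := mulmx1C MK => /matrixP/(_ (enum_rank t) (enum_rank t')); rewrite !mxE.
under eq_bigr do rewrite !mxE !enum_rankK.
rewrite (inj_eq enum_rank_inj) => <-.
have -> : \sum_(A | P A) b t A * a A t' = \sum_(A in P) b t A * a A t' by [].
rewrite big_enum_val (reindex (cast_ord (esym e))) //=.
by exists (cast_ord e) => i _; rewrite (cast_ordK, cast_ordKV).
Qed.

(** * Continuity *)

Section Lipschitz.
Variable R : realType.
Local Notation C := R[i].
Local Notation normc := (@Normc.normc R).

(** All the maps in play are real linear in finite dimension, so a global Lipschitz bound is
    available and gives continuity on every subset. *)
Definition lipschitz (X Y : Type) (dX : X -> X -> R) (dY : Y -> Y -> R) (f : X -> Y) :=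
  exists2 K : R, 0 <= K & forall x y, dY (f x) (f y) <= K * dX x y.

Lemma lipschitz_cont (X Y : Type) (dX : X -> X -> R) (dY : Y -> Y -> R) P f :
  lipschitz dX dY f -> cont_on dX dY P f.
Proof.
move=> [K K0 Kf] x _ e e0; have K1 : 0 < K + 1 by rewrite ltr_wpDl.
(* Dividing by [K + 1] instead of [K] covers [K = 0]. *)
exists (e / (K + 1)) => [|y _ xy]; first exact: divr_gt0.
apply: le_lt_trans (Kf _ _) _.
apply: (@le_lt_trans _ _ (K * (e / (K + 1)))).
  by apply: ler_wpM2l => //; exact: ltW.
by rewrite mulrCA gtr_pMr // ltr_pdivrMr // mul1r ltrDl.
Qed.

Lemma normc_ge0 (x : C) : 0 <= normc x.
Proof. by case: x => a b /=; exact: sqrtr_ge0. Qed.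

Lemma normc_sum (I : Type) (r : seq I) (P : pred I) (F : I -> C) :
  normc (\sum_(i <- r | P i) F i) <= \sum_(i <- r | P i) normc (F i).
Proof.
elim/big_ind2: _ => [|x a y b xa yb|//]; first by rewrite Normc.normc0.
by apply: le_trans (le_normcD _ _) _; exact: lerD.
Qed.

Definition mxnorm m (A : 'M[C]_m) : R := \sum_i \sum_j normc (A i j).

Lemma mx_distE m (A B : 'M[C]_m) : mx_dist A B = mxnorm (A - B).
Proof. by apply: eq_bigr => i _; apply: eq_bigr => j _; rewrite !mxE. Qed.

Lemma mxnorm_ge0 m (A : 'M[C]_m) : 0 <= mxnorm A.
Proof. by apply: sumr_ge0 => i _; apply: sumr_ge0 => j _; exact: normc_ge0. Qed.

Lemma mxnormM m (A B : 'M[C]_m) : mxnorm (A *m B) <= mxnorm A * mxnorm B.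
Proof.
rewrite /mxnorm mulr_suml; apply: ler_sum => i _.
rewrite mulr_suml.
apply: (@le_trans _ _ (\sum_j \sum_k normc (A i k) * normc (B k j))).
  apply: ler_sum => j _; rewrite mxE; apply: le_trans (normc_sum _ _ _) _.
  by apply: ler_sum => k _; rewrite Normc.normcM.
rewrite exchange_big /=; apply: ler_sum => k _; rewrite -mulr_sumr.
apply: ler_wpM2l; first exact: normc_ge0.
rewrite [leRHS](bigD1 k) //= lerDl; apply: sumr_ge0 => l _.
by apply: sumr_ge0 => j _; exact: normc_ge0.
Qed.

Lemma mxnorm_tr m (A : 'M[C]_m) : normc (\tr A) <= mxnorm A.
Proof.
apply: le_trans (normc_sum _ _ _) _; apply: ler_sum => i _.
rewrite (bigD1 i) //= lerDl; apply: sumr_ge0 => j _; exact: normc_ge0.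
Qed.

Lemma mxnormZ m a (A : 'M[C]_m) : mxnorm (a *: A) = normc a * mxnorm A.
Proof.
rewrite /mxnorm mulr_sumr; apply: eq_bigr => i _; rewrite mulr_sumr.
by apply: eq_bigr => j _; rewrite mxE Normc.normcM.
Qed.

Lemma mxnorm_sum m (I : finType) (F : I -> 'M[C]_m) :
  mxnorm (\sum_i F i) <= \sum_i mxnorm (F i).
Proof.
rewrite [leRHS]exchange_big; apply: ler_sum => i _ /=.
rewrite exchange_big; apply: ler_sum => j _ /=.
by rewrite summxE; exact: normc_sum.
Qed.

Lemma lipschitz_conj m (A B : 'M[C]_m) :
  lipschitz (@mx_dist R m) (@mx_dist R m) (fun X => A *m X *m B).
Proof.
exists (mxnorm A * mxnorm B) => [|X Y]; first by apply: mulr_ge0; exact: mxnorm_ge0.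
rewrite !mx_distE -mulmxBl -mulmxBr mulrAC.
apply: le_trans (mxnormM _ _) _; apply: ler_wpM2r; first exact: mxnorm_ge0.
exact: mxnormM.
Qed.

Lemma cont_on_comp (X Y Z : Type) dX dY dZ (P : X -> Prop) (Q : Y -> Prop)
    (f : X -> Y) (g : Y -> Z) : (forall x, P x -> Q (f x)) ->
  @cont_on R X Y dX dY P f -> @cont_on R Y Z dY dZ Q g -> cont_on dX dZ P (g \o f).
Proof.
move=> PQ cf cg x Px e e0.
have [d d0 dg] := cg _ (PQ _ Px) _ e0; have [c c0 cf'] := cf _ Px _ d0.
by exists c => // y Py xy; apply: dg; [exact: PQ|exact: cf'].
Qed.

Lemma lie_iso_conj p q m (G : cl R (p + q) -> Prop) (H H' : 'M[C]_m -> Prop)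
    (P : 'M[C]_m) : P \in unitmx ->
  (forall X, H X <-> H' (P *m X *m invmx P)) -> lie_iso G H -> lie_iso G H'.
Proof.
move=> uP HH' [f [g [fG [gH [gf [fg [fM [cf cg]]]]]]]].
pose c X := P *m X *m invmx P; pose d X := invmx P *m X *m P.
have cd X : c (d X) = X by rewrite /c /d !mulmxA mulmxV // mul1mx mulmxK.
have dc X : d (c X) = X by rewrite /c /d !mulmxA mulVmx // mul1mx mulmxKV.
have H'H X : H' X -> H (d X) by move=> h; apply/HH'; rewrite -/(c _) cd.
exists (c \o f), (g \o d); do !split => /=.
- by move=> U /fG /HH'.
- by move=> X /H'H /gH.
- by move=> U GU; rewrite dc gf.
- by move=> X /H'H HX; rewrite fg.
- by move=> U V GU GV; rewrite fM // /c !mulmxA mulmxKV.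
- by apply: (cont_on_comp fG cf); apply: lipschitz_cont; exact: lipschitz_conj.
- apply: (cont_on_comp H'H _ cg); apply: lipschitz_cont; exact: lipschitz_conj.
Qed.

End Lipschitz.

(** * Representation of a real form of the Clifford algebra *)

Section Rep.
Variables (R : realType) (p q N : nat).
Local Notation C := R[i].
Local Notation n := (p + q)%N.
Local Notation cl := (cl R n).
Local Notation bc := (@blade_coef R p n).
Local Notation creal z := ((z : C) \is Num.real).
Variables (f : {rmorphism C -> C}) (I : pred {set 'I_n}) (w : {set 'I_n} -> C).
Variables (E : {set 'I_n} -> 'M[C]_N) (J : 'M[C]_N) (sig : cl -> cl).

(* The real span of the elements [(w A)^-1 e^A], [A] in [I]. *)
Definition real_form (U : cl) : Prop :=
  forall A, creal (w A * U A) /\ (~~ I A -> U A = 0).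

Definition rep (U : cl) : 'M[C]_N := \sum_A U A *: E A.

Hypothesis N0 : (0 < N)%N.
Hypothesis w_val : forall A, w A = 1 \/ w A = 'i%C.
Hypothesis w0 : w set0 = 1.
Hypothesis I0 : I set0.
Hypothesis Isymd : forall A B, I A -> I B -> I (symd A B).
Hypothesis wsymd : forall A B, I A -> I B -> creal (w (symd A B) * w A * w B).
Hypothesis E0 : E set0 = 1%:M.
Hypothesis EM : forall A B, I A -> I B -> E A *m E B = bc A B *: E (symd A B).
Hypothesis Etr : forall A, I A -> A != set0 -> complex.Re (w A * \tr (E A)) = 0.
Hypothesis cardI : #|I| = (N * N * 2)%N.
Hypothesis Ju : J \in unitmx.
Hypothesis sig_form : forall U, real_form U -> real_form (sig U).
Hypothesis sig_star : forall U A, real_form U -> I A ->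
  f (U A) *: (star f (E A) *m J) = sig U A *: (J *m E A).

Lemma w_neq0 A : w A != 0.
Proof.
by case: (w_val A) => ->; rewrite ?oner_eq0 // eq_complex /= oner_eq0 andbF.
Qed.

Lemma w_sqr_real A : creal (w A * w A).
Proof.
case: (w_val A) => ->; first by rewrite mulr1 real1.
by rewrite mulii realN real1.
Qed.

Lemma real_form_out U A : real_form U -> ~~ I A -> U A = 0.
Proof. by move=> h; case: (h A). Qed.

(** The matrices [E A] multiply like the blades only for indices in [I]; membership in the real form
    confines the supports to [I]. *)
Lemma rep_mul U V : real_form U -> real_form V ->
  rep (clmul U V) = rep U *m rep V.
Proof.
move=> hU hV; rewrite /rep mulmx_suml.
under eq_bigr => D _ do rewrite ffunE scaler_suml.
rewrite exchange_big; apply: eq_bigr => A _.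
rewrite mulmx_sumr; under eq_bigr => D _ do rewrite scaler_suml.
rewrite exchange_big; apply: eq_bigr => B _.
rewrite (bigD1 (symd A B)) //= eqxx big1 ?addr0 => [|D]; last first.
  by rewrite eq_sym => /negbTE ->; rewrite scale0r.
have [IA|/(real_form_out hU) ->] := boolP (I A); last first.
  by rewrite !mul0r !scale0r mul0mx.
have [IB|/(real_form_out hV) ->] := boolP (I B); last first.
  by rewrite mulr0 mul0r !scale0r mulmx0.
by rewrite -scalemxAl -scalemxAr EM // !scalerA.
Qed.

Lemma real_form_mul U V : real_form U -> real_form V -> real_form (clmul U V).
Proof.
move=> hU hV D; rewrite ffunE; split; last first.
  move=> ID; rewrite big1 // => A _; rewrite big1 // => B _.
  case: eqP => // e; have [IA|/(real_form_out hU) ->] := boolP (I A); last by rewrite !mul0r.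
  have [IB|/(real_form_out hV) ->] := boolP (I B); last by rewrite mulr0 mul0r.
  by rewrite -e Isymd in ID.
rewrite mulr_sumr; apply: rpred_sum => A _; rewrite mulr_sumr; apply: rpred_sum => B _.
case: eqP => [<-|_]; last by rewrite mulr0 real0.
have [IA|/(real_form_out hU) ->] := boolP (I A); last by rewrite !mul0r mulr0 real0.
have [IB|/(real_form_out hV) ->] := boolP (I B); last by rewrite mulr0 mul0r mulr0 real0.
(* Multiplying by this nonzero real number supplies the phases that make each factor real
   separately. *)
rewrite -(@realrM _ _ (w A * w A * (w B * w B))); last first.
- by apply: realM; exact: w_sqr_real.
- by rewrite !mulf_neq0 ?w_neq0.
have -> : w (symd A B) * (U A * V B * bc A B) * (w A * w A * (w B * w B)) =
  w (symd A B) * w A * w B * (w A * U A) * (w B * V B) * bc A B.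
  by ring.
apply: realM; last exact: blade_coef_real.
apply: realM; last by case: (hV B).
by apply: realM; [exact: wsymd|case: (hU A)].
Qed.

(** Since [E A] squares to the sign [bc A A], the inverse of [(w A)^-1 *: E A] is
    [w A * bc A A *: E A]; this is the real trace pairing with that inverse, normalised by [N]. *)
Definition coord (X : 'M[C]_N) A : R := complex.Re (w A * bc A A * \tr (E A *m X)) / N%:R.

Definition unrep (X : 'M[C]_N) : cl :=
  [ffun A => if I A then (coord X A)%:C%C / w A else 0].

Lemma real_form_unrep X : real_form (unrep X).
Proof.
move=> A; rewrite ffunE; case: ifP => //= _; last by rewrite mulr0 real0.
split=> //; rewrite mulrC mulfVK ?w_neq0 //; apply/complex_realP; by exists (coord X A).
Qed.

Lemma coord_sum A (T : finType) (P : pred T) (F : T -> 'M[C]_N) :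
  coord (\sum_(t | P t) F t) A = \sum_(t | P t) coord (F t) A.
Proof.
rewrite /coord mulmx_sumr raddf_sum mulr_sumr raddf_sum mulr_suml.
by apply: eq_bigr.
Qed.

Lemma ReZ (a : R) (z : C) : complex.Re (a%:C%C * z) = a * complex.Re z.
Proof. by case: z => x y /=; rewrite mul0r subr0. Qed.

Lemma ImZ (a : R) (z : C) : complex.Im (a%:C%C * z) = a * complex.Im z.
Proof. by case: z => x y /=; rewrite mul0r addr0. Qed.

Lemma coordZ a X A : coord (a%:C%C *: X) A = a * coord X A.
Proof. by rewrite /coord -scalemxAr mxtraceZ mulrCA ReZ [RHS]mulrA. Qed.

(** The real basis is orthonormal for the trace pairing: for [A != B] the product of the two blades
    is a multiple of the blade of the nonempty set [symd A B], to which [Etr] applies. *)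
Lemma coordE A B : I A -> I B -> coord ((w B)^-1 *: E B) A = (A == B)%:R.
Proof.
move=> IA IB; rewrite /coord -scalemxAr EM // !mxtraceZ.
have [<-|AB] := eqVneq A B.
  rewrite symdxx E0 mxtrace1.
  have -> : w A * bc A A * ((w A)^-1 * (bc A A * N%:R)) = N%:R.
    rewrite mulrACA [bc _ _ * (_ * _)]mulrA blade_coef_sqr mul1r mulfV ?w_neq0 //.
    by rewrite mul1r.
  by rewrite -(rmorph_nat (real_complex R)) /= divff // pnatr_eq0 -lt0n.
set D := symd A B; have D0 : D != set0 by rewrite symd_eq0.
have ID : I D by exact: Isymd.
(* The phases are regrouped as a real number times [w D * \tr (E D)], whose real part vanishes. *)
have -> : w A * bc A A * ((w B)^-1 * (bc A B * \tr (E D))) =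
    (bc A A * bc A B * (w D * w A * w B) / (w B * w B) / (w D * w D)) * (w D * \tr (E D)).
  by field; rewrite !w_neq0.
set r := (X in X * (w D * _)); have /complex_realP[k ->] : creal r.
  rewrite /r; apply: realM; last by rewrite realV w_sqr_real.
  apply: realM; last by rewrite realV w_sqr_real.
  by apply: realM; [apply: realM; exact: blade_coef_real|exact: wsymd].
by rewrite ReZ Etr // mulr0 mul0r.
Qed.

Lemma unrepK U : real_form U -> unrep (rep U) = U.
Proof.
move=> hU; apply/ffunP => A; rewrite ffunE.
case: ifP => IA; last by rewrite (real_form_out hU) ?IA.
have -> : rep U = \sum_(B | I B) (complex.Re (w B * U B))%:C%C *: ((w B)^-1 *: E B).
  rewrite /rep (bigID I) /= [X in _ + X]big1 ?addr0 => [|B IB]; last first.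
    by rewrite (real_form_out hU) ?scale0r.
  apply: eq_bigr => B _; rewrite RRe_real; last by case: (hU B).
  by rewrite scalerA mulrAC mulfV ?w_neq0 // mul1r.
have hA : creal (w A * U A) by case: (hU A).
have -> : coord (\sum_(B | I B) (complex.Re (w B * U B))%:C%C *: ((w B)^-1 *: E B)) A
    = complex.Re (w A * U A).
  rewrite coord_sum (bigD1 A) //= big1 => [|B /andP[IB BA]]; last first.
    by rewrite coordZ coordE // eq_sym (negbTE BA) mulr0.
  by rewrite addr0 coordZ coordE // eqxx mulr1.
by rewrite RRe_real // mulrAC mulfV ?w_neq0 // mul1r.
Qed.

Definition mxcoord (t : 'I_N * 'I_N * bool) (X : 'M[C]_N) : R :=
  if t.2 then complex.Im (X t.1.1 t.1.2) else complex.Re (X t.1.1 t.1.2).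

(** The flag separates the real basis matrices from their multiples by [i], so that [Mat(N, C)] is
    treated as a real space of dimension [2 N^2]. *)
Definition mxbase (t : 'I_N * 'I_N * bool) : 'M[C]_N :=
  (if t.2 then 'i%C else 1) *: delta_mx t.1.1 t.1.2.

Lemma mxcoord_sum t (T : finType) (P : pred T) (F : T -> 'M[C]_N) :
  mxcoord t (\sum_(i | P i) F i) = \sum_(i | P i) mxcoord t (F i).
Proof. by rewrite /mxcoord summxE; case: t.2; rewrite raddf_sum; apply: eq_bigr. Qed.

Lemma mxcoordZ t a X : mxcoord t (a%:C%C *: X) = a * mxcoord t X.
Proof. by rewrite /mxcoord mxE; case: t.2; rewrite (ReZ, ImZ). Qed.

Lemma mxcoordK X : X = \sum_t (mxcoord t X)%:C%C *: mxbase t.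
Proof.
rewrite [LHS]matrix_sum_delta pair_bigA /= -(pair_bigA _ (fun ij b =>
  (mxcoord (ij, b) X)%:C%C *: mxbase (ij, b))) /=.
apply: eq_bigr => -[i j] _; rewrite big_bool /= /mxcoord /mxbase /= !scalerA -scalerDl.
by congr (_ *: _); rewrite [LHS]complexE mulr1 addrC mulrC.
Qed.

(** Orthonormality gives one product of the two coordinate matrices [a] and [b]. By [cardI] they are
    square, so the product in the other order is the identity as well, which is surjectivity. *)
Lemma repK X : rep (unrep X) = X.
Proof.
pose a A t := mxcoord t ((w A)^-1 *: E A).
pose b t B := coord (mxbase t) B.
have ab A B : I A -> I B -> \sum_t a A t * b t B = (A == B)%:R.
  move=> IA IB; rewrite eq_sym -coordE // [in RHS](mxcoordK (_ *: _)).
  by rewrite coord_sum; apply: eq_bigr => t _; rewrite coordZ.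
have cT : #|I| = #|{: 'I_N * 'I_N * bool}| by rewrite cardI !card_prod card_ord card_bool.
have ba := sq_inverse cT ab.
rewrite [RHS]mxcoordK [LHS]mxcoordK; apply: eq_bigr => t _; congr (_%:C%C *: _).
have -> : rep (unrep X) = \sum_(A | I A) (coord X A)%:C%C *: ((w A)^-1 *: E A).
  rewrite /rep (bigID I) /= [X in _ + X]big1 ?addr0 => [|A /negbTE IA]; last first.
    by rewrite ffunE IA scale0r.
  by apply: eq_bigr => A IA; rewrite ffunE IA scalerA.
rewrite mxcoord_sum.
have -> : \sum_(A | I A) mxcoord t ((coord X A)%:C%C *: ((w A)^-1 *: E A)) =
    \sum_(A | I A) \sum_s mxcoord s X * (b s A * a A t).
  apply: eq_bigr => A _; rewrite mxcoordZ {1}[X]mxcoordK coord_sum mulr_suml.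
  by apply: eq_bigr => s _; rewrite coordZ mulrA.
rewrite exchange_big /= (bigD1 t) //= -mulr_sumr ba eqxx mulr1 big1 ?addr0 // => s st.
by rewrite -mulr_sumr ba (negbTE st) mulr0.
Qed.

Lemma star_sum (T : finType) (F : T -> 'M[C]_N) :
  star f (\sum_t F t) = \sum_t star f (F t).
Proof.
apply/matrixP => i j; rewrite !mxE !summxE rmorph_sum.
by apply: eq_bigr => t _; rewrite !mxE.
Qed.

(** As [J] is invertible, [sig] is carried to the involution sending [X] to [J^-1 (star f X) J]. *)
Lemma rep_star U : real_form U -> star f (rep U) *m J = J *m rep (sig U).
Proof.
move=> hU; rewrite /rep star_sum mulmx_suml mulmx_sumr; apply: eq_bigr => A _.
rewrite starZ -scalemxAl -scalemxAr; have [IA|IA] := boolP (I A); first exact: sig_star.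
by rewrite !(real_form_out _ IA) ?rmorph0 ?scale0r //; exact: sig_form.
Qed.

Lemma rep1 : rep (clone R n) = 1%:M.
Proof.
rewrite /rep (bigD1 set0) //= ffunE eqxx scale1r E0 big1 ?addr0 // => A /negbTE A0.
by rewrite ffunE A0 scale0r.
Qed.

Lemma real_form1 : real_form (clone R n).
Proof.
move=> A; rewrite ffunE; case: eqP => [->|_]; first by rewrite w0 mulr1 I0 real1.
by rewrite mulr0 real0.
Qed.

Lemma rep_lipschitz : lipschitz (@cl_dist R n) (@mx_dist R N) rep.
Proof.
exists (\sum_A mxnorm (E A)) => [|U V]; first by apply: sumr_ge0 => A _; exact: mxnorm_ge0.
rewrite mx_distE /rep -sumrB /cl_dist mulr_sumr.
apply: le_trans (mxnorm_sum _) _; apply: ler_sum => A _.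
rewrite -scalerBl mxnormZ [leLHS]mulrC; apply: (ler_wpM2r (normc_ge0 (U A - V A))).
rewrite (bigD1 A) //= lerDl; apply: sumr_ge0 => B _; exact: mxnorm_ge0.
Qed.

Lemma coordB X Y A : coord (X - Y) A = coord X A - coord Y A.
Proof. by rewrite /coord mulmxBr raddfB /= mulrBr raddfB /= mulrBl. Qed.

Lemma normc_Re (z : C) : Normc.normc (complex.Re z)%:C%C <= Normc.normc z.
Proof.
case: z => a b /=; rewrite expr0n /= addr0; apply: ler_wsqrtr.
by rewrite lerDl sqr_ge0.
Qed.

Lemma unrep_lipschitz : lipschitz (@mx_dist R N) (@cl_dist R n) unrep.
Proof.
pose K A := Normc.normc (w A * bc A A) * mxnorm (E A)
  * Normc.normc ((N%:R^-1 : R)%:C%C / w A).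
have K0 A : 0 <= K A by rewrite !mulr_ge0 ?normc_ge0 ?mxnorm_ge0.
exists (\sum_A K A) => [|X Y]; first by apply: sumr_ge0 => A _.
rewrite mx_distE /cl_dist mulr_suml; apply: ler_sum => A _; rewrite !ffunE.
have d0 : 0 <= K A * mxnorm (X - Y) by rewrite mulr_ge0 ?mxnorm_ge0.
case: ifP => _; last by rewrite subrr Normc.normc0.
rewrite -mulrBl -rmorphB /= -coordB.
have -> : (coord (X - Y) A)%:C%C / w A =
    (complex.Re (w A * bc A A * \tr (E A *m (X - Y))))%:C%C * ((N%:R^-1 : R)%:C%C / w A).
  by rewrite mulrA /coord rmorphM.
rewrite Normc.normcM /K [leRHS]mulrAC; apply: ler_wpM2r; first exact: normc_ge0.
apply: le_trans (normc_Re _) _; rewrite Normc.normcM -mulrA.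
apply: ler_wpM2l; first exact: normc_ge0.
exact: le_trans (mxnorm_tr _) (mxnormM _ _).
Qed.

(** Through [rep_star], the equation [sig U * U = 1] becomes invariance of the form [J]. *)
Lemma rep_iso (G : cl -> Prop) :
  (forall U, G U <-> real_form U /\ clmul (sig U) U = clone R n) ->
  lie_iso G (fun X => star f X *m J *m X = J).
Proof.
move=> GE; have JI (X : 'M_N) : J *m X = J -> X = 1%:M.
  by move=> /(congr1 (mulmx (invmx J))); rewrite mulKmx // mulVmx.
exists rep, unrep; do !split.
- move=> U /GE[hU e]; rewrite rep_star // -mulmxA -rep_mul ?e ?rep1 ?mulmx1 //.
  exact: sig_form.
- move=> X h; apply/GE; have hU := real_form_unrep X; split=> //.
  rewrite -{1}(repK X) rep_star // -mulmxA -[X in J *m (_ *m X)]repK in h.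
  rewrite -rep_mul // in h; last exact: sig_form.
  (* The matrix identity is pulled back by [unrepK], which asks that the product [sig U * U] again
     lie in the real form. *)
  move/JI: h => h; rewrite -[LHS]unrepK ?h -?rep1 ?unrepK //; first exact: real_form1.
  by apply: real_form_mul => //; exact: sig_form.
- by move=> U /GE[hU _]; exact: unrepK.
- by move=> X _; exact: repK.
- by move=> U V /GE[hU _] /GE[hV _]; exact: rep_mul.
- exact: lipschitz_cont rep_lipschitz.
- exact: lipschitz_cont unrep_lipschitz.
Qed.

End Rep.

(** * Congruence of forms *)

Section Congruence.
Variable R : realType.
Local Notation C := R[i].
Local Notation ii := ('i%C : C).
Implicit Type f : {rmorphism C -> C}.

Lemma star_id m (A : 'M[C]_m) : star idfun A = A^T.
Proof. by rewrite /star map_mx_id. Qed.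

(** The factor [mu] is harmless: a form and its nonzero multiples have the same isometry group. *)
Definition congruent f m (X Y : 'M[C]_m) := exists2 P, P \in unitmx &
  exists2 mu : C, mu != 0 & star f P *m Y *m P = mu *: X.

Lemma congruent_trans f m (X Y Z : 'M[C]_m) :
  congruent f X Y -> congruent f Y Z -> congruent f X Z.
Proof.
move=> [P uP [mu mu0 e]] [Q uQ [nu nu0 e']].
exists (Q *m P); first by rewrite unitmx_mul uQ uP.
exists (nu * mu); first exact: mulf_neq0.
have -> : star f (Q *m P) *m Z *m (Q *m P) = star f P *m (star f Q *m Z *m Q) *m P.
  by rewrite starM !mulmxA.
by rewrite e' -scalemxAr -scalemxAl e scalerA.
Qed.

Lemma congruent_scale f m (X : 'M[C]_m) a : a != 0 -> congruent f X (a *: X).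
Proof.
move=> a0; exists 1%:M; first exact: unitmx1.
by exists a => //; rewrite star1 mul1mx mulmx1.
Qed.

Lemma lie_iso_congruent f p q m (G : cl R (p + q) -> Prop) (J K : 'M[C]_m) :
  congruent f J K -> lie_iso G (fun X => star f X *m J *m X = J) ->
  lie_iso G (fun X => star f X *m K *m X = K).
Proof.
move=> [P uP [mu mu0 e]]; apply: (lie_iso_conj uP) => X.
set Y := P *m X *m invmx P.
have YP : Y *m P = P *m X by rewrite /Y mulmxKV.
clearbody Y.
have PV : star f (invmx P) *m star f P = 1%:M by rewrite -starM mulmxV // star1.
have key : star f P *m (star f Y *m K *m Y) *m P = mu *: (star f X *m J *m X).
  have -> : star f P *m (star f Y *m K *m Y) *m P = star f (Y *m P) *m K *m (Y *m P).
    by rewrite (starM f Y P) !mulmxA.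
  rewrite YP (starM f P X).
  have -> : star f X *m star f P *m K *m (P *m X) = star f X *m (star f P *m K *m P) *m X.
    by rewrite !mulmxA.
  by rewrite e -scalemxAr -scalemxAl.
split=> h.
  have : star f P *m (star f Y *m K *m Y) *m P = star f P *m K *m P by rewrite key h e.
  move=> /(congr1 (fun A => star f (invmx P) *m (A *m invmx P))).
  by rewrite !mulmxK // !mulmxA PV !mul1mx.
by move: key; rewrite h e => /(scalerI mu0).
Qed.

Lemma unitmx_of_sqr m (X : 'M[C]_m) (a : C) : a != 0 -> X *m X = a%:M -> X \in unitmx.
Proof.
move=> a0 XX; have : X *m X \in unitmx.
  by rewrite XX unitmxE det_scalar unitfE expf_neq0.
by rewrite unitmx_mul => /andP[].
Qed.

(** With [P = X + nu Y] and [nu ^+ 2 = kap], the terms in [Y] cancel in [P Y P] and [2 nu X]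
    remains. The condition on [f nu] makes [star f P] equal to [eps *: P]. *)
Lemma congruent_anticomm f m (X Y : 'M[C]_m) (kap eps del nu : C) :
  X *m X = kap%:M -> Y *m Y = 1%:M -> X *m Y = - (Y *m X) ->
  star f X = eps *: X -> star f Y = del *: Y ->
  nu ^+ 2 = kap -> kap != 0 -> eps != 0 -> f nu * del = eps * nu -> congruent f X Y.
Proof.
move=> XX YY XY sX sY nu2 kap0 eps0 fnu.
have nu0 : nu != 0 by apply: contra_neq kap0 => n0; rewrite -nu2 n0 expr0n.
pose P := X + nu *: Y.
have sP : star f P = eps *: P.
  by rewrite scalerDr scalerA -fnu -scalerA -sX -sY -starZ /star map_mxD linearD.
have PYP : P *m Y *m P = (2 * nu) *: X.
  have -> : P *m Y = X *m Y + nu%:M by rewrite mulmxDl -scalemxAl YY scalemx1.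
  rewrite mulmxDl !mulmxDr !mul_scalar_mx -scalemxAr -[X *m Y *m Y]mulmxA YY mulmx1.
  rewrite {1}XY mulNmx -mulmxA XX mul_mx_scalar scalerA -expr2 nu2.
  by rewrite addrC [- _ + _]addrC addrACA subrr addr0 -scalerDl mulrDl mul1r.
have e : star f P *m Y *m P = (eps * (2 * nu)) *: X.
  by rewrite sP -!scalemxAl PYP scalerA.
have c0 : eps * (2 * nu) != 0 by rewrite !mulf_neq0 // pnatr_eq0.
exists P; last by exists (eps * (2 * nu)).
(* [P] is invertible because it divides a nonzero multiple of the invertible matrix [X]. *)
have : (eps * (2 * nu)) *: X \in unitmx.
  by rewrite unitmxZ ?unitfE //; exact: unitmx_of_sqr XX.
by rewrite -e unitmx_mul => /andP[].
Qed.

(** This is for bilinear forms only: transposition fixes scalars, so any complex square root of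
    [- kap] may serve as [nu]. *)
Lemma congruent_comm m (X Y : 'M[C]_m) (kap eps : C) :
  X *m X = kap%:M -> Y *m Y = 1%:M -> X *m Y = Y *m X ->
  X^T = eps *: X -> Y^T = eps *: Y -> eps ^+ 2 = 1 -> kap != 0 ->
  congruent idfun X Y.
Proof.
move=> XX YY XY tX tY eps2 kap0.
pose nu := sqrtc (- kap); have nu2 : nu ^+ 2 = - kap by exact: sqr_sqrtc.
have nu0 : nu != 0.
  apply: contra_neq kap0 => n0; move: nu2; rewrite n0 expr0n => /eqP.
  by rewrite eq_sym oppr_eq0 => /eqP.
(* [(X Y) ^+ 2 = kap], so [Q ^+ 2 = 2 nu X Y] for the symmetric matrix [Q]. *)
pose Q := X *m Y + nu%:M.
have sQ : star idfun Q = Q.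
  rewrite star_id /Q linearD /= tr_scalar_mx trmx_mul tX tY -scalemxAl -scalemxAr.
  by rewrite scalerA -expr2 eps2 scale1r XY.
have QQ : Q *m Q = (2 * nu) *: (X *m Y).
  rewrite /Q mulmxDl !mulmxDr -scalar_mxM -expr2 nu2 mul_mx_scalar mul_scalar_mx.
  have -> : X *m Y *m (X *m Y) = kap%:M.
    by rewrite {1}XY -mulmxA [X *m (X *m Y)]mulmxA XX mul_scalar_mx -scalemxAr YY scalemx1.
  by rewrite raddfN /= [_ *: _ - _]addrC addrACA subrr add0r mulrDl mul1r scalerDl.
have e : star idfun Q *m Y *m Q = (2 * nu) *: X.
  rewrite sQ; have -> : Q *m Y = Y *m Q.
    by rewrite /Q mulmxDl mulmxDr mul_mx_scalar mul_scalar_mx mulmxA -XY.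
  rewrite -mulmxA QQ -scalemxAr mulmxA -XY -mulmxA YY mulmx1 //.
have c0 : 2 * nu != 0 by rewrite mulf_neq0 // pnatr_eq0.
exists Q; last by exists (2 * nu).
have : (2 * nu) *: X \in unitmx.
  by rewrite unitmxZ ?unitfE //; exact: unitmx_of_sqr XX.
by rewrite -e unitmx_mul => /andP[].
Qed.

Lemma blade_unitary f N (E : nat -> 'M[C]_N) c m :
  (forall i, (i < m)%N -> star f (E i) *m E i = 1%:M) ->
  star f (blade E c m) *m blade E c m = 1%:M.
Proof.
elim: m => [|m IH] h /=; first by rewrite star1 mulmx1.
rewrite starM -mulmxA [star f (blade _ _ _) *m _]mulmxA IH => [|i im]; last first.
  by apply: h; exact: ltnW.
by rewrite mul1mx; case: (c m); rewrite ?h // star1 mulmx1.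
Qed.

Lemma gamma_blade_herm k c : let b := blade (gamma R k) c k.*2.+1 in
  star conjc b = (-1) ^+ 'C(cnt c k.*2.+1, 2) *: b.
Proof.
have := @blade_star _ _ conjc (gamma R k) c 1%:M 1 k.*2.+1 (@gamma_anticomm R k).
rewrite mulmx1 mul1mx expr1n mul1r; apply=> i _ _.
by rewrite gamma_herm mulmx1 mul1mx scale1r.
Qed.

Lemma gamma_blade_sqr k c : let b := blade (gamma R k) c k.*2.+1 in
  b *m b = ((-1) ^+ 'C(cnt c k.*2.+1, 2))%:M.
Proof.
(* A blade of gammas is unitary and equals its adjoint up to sign, so its square is that sign. *)
move=> b; have : star conjc b *m b = 1%:M.
  by apply: blade_unitary => i _; rewrite gamma_herm gamma_sqr.
rewrite gamma_blade_herm -scalemxAl => /(congr1 (fun A => (-1) ^+ 'C(cnt c k.*2.+1, 2) *: A)).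
by rewrite scalerA -expr2 sqrr_sign scale1r scalemx1.
Qed.

Lemma gamma_blade_unit k c : blade (gamma R k) c k.*2.+1 \in unitmx.
Proof.
by apply: unitmx_of_sqr (gamma_blade_sqr k c); rewrite signr_eq0.
Qed.

(** The sign counts the factors other than [a]; the sum [cnt + c a] has the parity of that
    difference. *)
Lemma gamma_blade_comm k c a : (a < k.*2.+1)%N ->
  let b := blade (gamma R k) c k.*2.+1 in
  gamma R k a *m b = (-1) ^+ (cnt c k.*2.+1 + c a) *: (b *m gamma R k a).
Proof.
move=> ak b; rewrite /b blade_commE => [|i im ia]; last first.
  by apply: gamma_anticomm => //; exact/nesym.
congr (_ *: _); rewrite -(cntD1 c a k.*2.+1) ak andbT -addnA addnn.
by rewrite -signr_odd -[RHS]signr_odd oddD odd_double addbF.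
Qed.

Lemma signature_congruent k c : (0 < cnt c k.+1.*2.+1 < k.+1.*2.+1)%N ->
  congruent conjc (blade (gamma R k.+1) c k.+1.*2.+1) (eta_rs R (gdim k) (gdim k)).
Proof.
set m := k.+1.*2.+1; set b := blade _ _ _ => c0m.
have [a am ca] := exists_anticomm c0m.
have ba : congruent conjc b (gamma R k.+1 a).
  pose e : C := (-1) ^+ 'C(cnt c m, 2).
  (* Both the square and the adjoint of [b] carry the sign [e]; this square root of [e] satisfies
     [conjc nu = e * nu]. *)
  pose nu : C := if odd 'C(cnt c m, 2) then ii else 1.
  apply: (@congruent_anticomm _ _ _ _ e e 1 nu).
  - exact: gamma_blade_sqr.
  - exact: gamma_sqr.
  - rewrite gamma_blade_comm // -signr_odd oddD oddb ca expr1 scaleN1r opprK //.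
  - exact: gamma_blade_herm.
  - by rewrite gamma_herm scale1r.
  - rewrite /nu /e -signr_odd; case: (odd _); first by rewrite sqr_i.
    by rewrite expr1n.
  - by rewrite signr_eq0.
  - by rewrite signr_eq0.
  - rewrite mulr1 /nu /e -signr_odd; case: (odd _); first by rewrite mulN1r; exact: conjci.
    by rewrite mulr1; exact: conjc1.
(* If [a] is not the last index, one more step exchanges [gamma_a] for the last gamma, with which it
   anticommutes. *)
rewrite /eta_rs -gamma_last; have [<-//|al] := eqVneq a k.*2.+2.
apply: (congruent_trans ba); apply: (@congruent_anticomm _ _ _ _ 1 1 1 1).
- exact: gamma_sqr.
- exact: gamma_sqr.
- by apply: gamma_anticomm => //; exact/eqP.
- by rewrite gamma_herm scale1r.
- by rewrite gamma_herm scale1r.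
- by rewrite expr1n.
- exact: oner_neq0.
- exact: oner_neq0.
- by rewrite !mulr1; exact: conjc1.
Qed.

Lemma cnt_odd k : cnt odd k.*2.+1 = k.
Proof. by elim: k => //= k IH; rewrite IH odd_double /= addn0 addn1. Qed.

(** The [k] antisymmetric factors give [(-1)^k] and their reversal gives ['C(k, 2)] further signs;
    Pascal's rule adds the exponents. *)
Lemma gamma_odd_tr k : let b := blade (gamma R k) odd k.*2.+1 in
  b^T = (-1) ^+ 'C(k.+1, 2) *: b.
Proof.
have := @blade_star _ _ idfun (gamma R k) odd 1%:M (-1) k.*2.+1 (@gamma_anticomm R k).
rewrite mulmx1 mul1mx cnt_odd star_id binS bin1 exprD mulrC; apply=> i im oi.
by rewrite star_id gamma_tr // -signr_odd oi mulmx1 mul1mx expr1.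
Qed.

(** The parity condition makes the form symmetric, and the identity is a symmetric involution
    commuting with it. *)
Lemma orthogonal_congruent k : ~~ odd 'C(k.+1, 2) ->
  congruent idfun (blade (gamma R k) odd k.*2.+1) 1%:M.
Proof.
move=> o; apply: (@congruent_comm _ _ _ _ 1).
- exact: gamma_blade_sqr.
- by rewrite mulmx1.
- by rewrite mulmx1 mul1mx.
- by rewrite gamma_odd_tr -signr_odd (negbTE o).
- by rewrite trmx1 scale1r.
- by rewrite expr1n.
- by rewrite signr_eq0.
Qed.

Lemma symplectic_congruent k : odd 'C(k.+2, 2) ->
  congruent idfun (blade (gamma R k.+1) odd k.+1.*2.+1) (Omega R (gdim k)).
Proof.
move=> o; set b := blade _ _ _; set g := gamma R k.+1 k.*2.+1.
have gO : congruent idfun g (Omega R (gdim k)).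
  have -> : Omega R (gdim k) = (- ii) *: g.
    by rewrite /g gamma_penult scalerA mulNr mulii opprK scale1r.
  by apply: congruent_scale; rewrite oppr_eq0 eq_complex /= oner_eq0 andbF.
apply: congruent_trans gO.
have bT : b^T = (-1) *: b by rewrite gamma_odd_tr -signr_odd o expr1.
have gT : g^T = (-1) *: g.
  rewrite /g gamma_tr; last by rewrite doubleS ltnS leqnSn.
  by rewrite -signr_odd oddS odd_double expr1.
have bb : b *m b = _ := gamma_blade_sqr _ _.
have gg : g *m g = 1%:M by exact: gamma_sqr.
have gb : g *m b = (-1) ^+ (k.+1 + 1) *: (b *m g).
  rewrite gamma_blade_comm; last by rewrite doubleS ltnS leqnSn.
  by rewrite cnt_odd oddS odd_double.
(* [g] is one of the [k.+1] factors of [b] and anticommutes with the other [k]: the parity of [k]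
   decides which of the two congruences applies. *)
rewrite addn1 -signr_odd /= negbK in gb; case ok: (odd k) in gb.
  pose nu := sqrtc ((-1) ^+ 'C(cnt odd k.+1.*2.+1, 2) : C).
  apply: (@congruent_anticomm _ _ _ _ _ (-1) (-1) nu bb gg).
  - by rewrite gb expr1 scaleN1r opprK.
  - by rewrite star_id.
  - by rewrite star_id.
  - exact: sqr_sqrtc.
  - by rewrite signr_eq0.
  - by rewrite oppr_eq0 oner_neq0.
  - by rewrite mulrC.
apply: (congruent_comm bb gg _ bT gT).
- by rewrite gb expr0 scale1r.
- by rewrite sqrrN expr1n.
- by rewrite signr_eq0.
Qed.

End Congruence.

(** * Representation of the generators *)

Section Generators.
Variables (R : realType) (p k : nat).
Local Notation C := R[i].
Local Notation ii := ('i%C : C).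
Local Notation m := k.*2.+1.

Definition gen (a : nat) : 'M[C]_(gdim k) := (if (a < p)%N then 1 else ii) *: gamma R k a.

Lemma gen_sqr a : gen a *m gen a = (etan R p a)%:M.
Proof.
rewrite /gen -scalemxAl -scalemxAr scalerA gamma_sqr scalemx1 /etan.
by case: ifP => _; rewrite ?mulr1 // mulii.
Qed.

Lemma gen_anticomm : anticomm gen m.
Proof.
move=> a b am bm ab; rewrite /gen -!scalemxAl -!scalemxAr (@gamma_anticomm R k a b am bm ab).
by rewrite !scalerN !scalerA mulrC.
Qed.

Definition neg (i : nat) : bool := (p <= i)%N.

Lemma cnt_neg j : cnt neg j = (j - p)%N.
Proof.
elim: j => //= j ->; rewrite /neg; case: leqP => pj; first by rewrite subSn // addn1.
by apply/eqP; rewrite addn0 (eqP (ltnW pj)) eq_sym subn_eq0.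
Qed.

(** To the [i ^+ k] of the gammas each generator of negative square adds one factor [i]. *)
Lemma gen_full : blade gen xpredT m = (ii ^+ (m - p + k))%:M.
Proof.
suff h j : blade gen xpredT j = ii ^+ (j - p) *: blade (gamma R k) xpredT j.
  by rewrite h gamma_full scale_scalar_mx exprD.
rewrite -cnt_neg; elim: j => [|j IH] /=; first by rewrite scale1r.
rewrite IH /gen -scalemxAl -scalemxAr scalerA /neg ltnNge exprD.
by case: (p <= j)%N.
Qed.

(** Some generator anticommutes with the blade; since its square is a nonzero scalar, cyclicity
    shows the trace to be its own opposite. *)
Lemma gen_trace c : (0 < cnt c m < m)%N -> \tr (blade gen c m) = 0.
Proof.
move=> /exists_anticomm[a am ca]; set b := blade _ _ _.
have e : gen a *m b = - (b *m gen a).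
  rewrite /b blade_commE => [|i im ia]; last first.
    by apply: gen_anticomm => //; exact/nesym.
  rewrite -(cntD1 c a) am andbT oddD oddb addbK in ca.
  by rewrite -signr_odd ca scaleN1r.
have eta0 : etan R p a != 0 by rewrite /etan; case: ifP; rewrite ?oppr_eq0 oner_neq0.
have : \tr (gen a *m (gen a *m b)) = - \tr (gen a *m (gen a *m b)).
  by rewrite {1}e mulmxN raddfN /=; congr (- _); rewrite [in LHS]mulmxA [LHS]mxtrace_mulC.
rewrite mulmxA gen_sqr mul_scalar_mx mxtraceZ => /eqP.
by rewrite -addr_eq0 -mulr2n mulrn_eq0 /= mulf_eq0 (negbTE eta0) => /eqP.
Qed.

Definition Jdag := blade (gamma R k) neg m.
Definition Jtr := blade (gamma R k) odd m.

(** For a generator of negative square, the sign from [conjc] on [i] cancels the one from [a] being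
    a factor of [Jdag]. The sign left is the same for all [a]. *)
Lemma gen_dag a : (a < m)%N ->
  star conjc (gen a) *m Jdag = (-1) ^+ (m - p) *: (Jdag *m gen a).
Proof.
move=> am; rewrite /gen starZ gamma_herm -scalemxAl gamma_blade_comm // -scalemxAr !scalerA.
congr (_ *: _); rewrite cnt_neg /neg ltnNge exprD; case: (p <= a)%N => /=; last first.
  by rewrite (conjc1 R : Complex 1 (- 0) = 1) expr0 !mulr1 mul1r.
by rewrite (conjci R : Complex 0 (- 1) = - ii) expr1 mulrN1 mulrNN mulrC.
Qed.

(** The sign of transposition at odd [a] cancels the one from [a] being a factor of [Jtr], so the
    sign is again uniform. *)
Lemma gen_tr a : (a < m)%N ->
  star idfun (gen a) *m Jtr = (-1) ^+ k *: (Jtr *m gen a).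
Proof.
move=> am; rewrite /gen starZ star_id gamma_tr // -!scalemxAl gamma_blade_comm //.
rewrite -scalemxAr !scalerA cnt_odd exprD -[(-1) ^+ a]signr_odd.
by congr (_ *: _); rewrite mulrACA -expr2 sqrr_sign mulr1 mulrC.
Qed.

End Generators.

(** * From the forms [Jdag] and [Jtr] to the classical groups *)

Section Targets.
Variables (R : realType) (p q : nat).
Variable G : cl R (p + q) -> Prop.

Lemma lie_iso_ext m (H H' : 'M[R[i]]_m -> Prop) : (forall X, H X <-> H' X) ->
  lie_iso G H -> lie_iso G H'.
Proof.
move=> HH'; apply: (lie_iso_conj (unitmx1 _ _)) => X.
by rewrite invmx1 mulmx1 mul1mx.
Qed.

(** In a definite signature [Jdag] is a scalar: the empty product, or the full product [i ^+ k]. *)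
Lemma lie_iso_U k p' : (k.*2.+1 - p' = 0)%N \/ p' = 0%N ->
  lie_iso G (fun X => star conjc X *m Jdag R p' k *m X = Jdag R p' k) ->
  lie_iso G (@Ugrp R (gdim k)).
Proof.
move=> hp; have [a a0 ->] : exists2 a, a != 0 & Jdag R p' k = a%:M.
  case: hp => hp; rewrite /Jdag.
    exists 1; first exact: oner_neq0.
    by rewrite blade_pred0 //; apply: cnt_eq0; rewrite cnt_neg.
  exists ('i%C ^+ k); first by rewrite expf_neq0 // eq_complex /= oner_eq0 andbF.
  by rewrite -gamma_full; apply: eq_blade => // i _; rewrite /neg hp.
have c1 : congruent conjc a%:M (1%:M : 'M[R[i]]_(gdim k)).
  have -> : 1%:M = a^-1 *: a%:M :> 'M[R[i]]_(gdim k) by rewrite scale_scalar_mx mulVf.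
  by apply: congruent_scale; rewrite invr_eq0.
by move=> /(lie_iso_congruent c1); apply: lie_iso_ext => X; rewrite mulmx1.
Qed.

Lemma lie_iso_Upq k p' : (0 < k.+1.*2.+1 - p' < k.+1.*2.+1)%N ->
  lie_iso G (fun X => star conjc X *m Jdag R p' k.+1 *m X = Jdag R p' k.+1) ->
  lie_iso G (@Upq R (gdim k) (gdim k)).
Proof.
by move=> hp; apply: lie_iso_congruent; apply: signature_congruent; rewrite cnt_neg.
Qed.

Lemma lie_iso_O k : ~~ odd 'C(k.+1, 2) ->
  lie_iso G (fun X => star idfun X *m Jtr R k *m X = Jtr R k) ->
  lie_iso G (@OC R (gdim k)).
Proof.
move=> o /(lie_iso_congruent (orthogonal_congruent R o)); apply: lie_iso_ext => X.
by rewrite star_id mulmx1.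
Qed.

Lemma lie_iso_Sp k : odd 'C(k.+2, 2) ->
  lie_iso G (fun X => star idfun X *m Jtr R k.+1 *m X = Jtr R k.+1) ->
  lie_iso G (@SpC R (gdim k)).
Proof.
move=> o /(lie_iso_congruent (symplectic_congruent R o)); apply: lie_iso_ext => X.
by rewrite star_id.
Qed.

End Targets.

(** * Real forms of odd dimension *)

Section Phases.
Variable R : realType.
Local Notation C := R[i].
Local Notation ii := ('i%C : C).

Lemma Re_odd_power_i e N : odd e -> complex.Re ((ii ^+ e) *+ N) = 0.
Proof.
move=> oe; rewrite -[e]odd_double_half oe add1n exprS -mul2n exprM sqr_i.
rewrite raddfMn /= -signr_odd; case: (odd _); last by rewrite expr0 mulr1 mul0rn.
by rewrite expr1 mulrN1 /= oppr0 mul0rn.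
Qed.

Lemma conjc_real_id (z : C) : z \is Num.real -> conjc z = z.
Proof. by move=> /complex_realP[r ->]; exact: conjc_real. Qed.

Lemma mul_i_real (z : C) : (ii * z \is Num.real) <-> 'Re z = 0.
Proof. by rewrite -ImMil -complexiE; split => /Creal_ImP. Qed.

(** With [b = false] the real form is the real algebra; with [b = true] odd blades have imaginary
    coefficients. *)
Definition phase (b : bool) n (A : {set 'I_n}) : C := if b && odd #|A| then ii else 1.

Lemma phase_symd_real b n (A B : {set 'I_n}) :
  phase b (symd A B) * phase b A * phase b B \is Num.real.
Proof.
have i2 : ii * ii \is Num.real by rewrite mulii realN real1.
rewrite /phase odd_card_symd.
by case: b (odd #|A|) (odd #|B|) => [] [] [] /=; rewrite ?mulr1 ?mul1r ?i2 ?real1.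
Qed.

(** On the real form, conjugation of coefficients is the identity or the grade involution, according
    to [b]. *)
Lemma phase_conj b p q (U : cl R (p + q)) : real_form predT (@phase b (p + q)) U ->
  forall A, conjc (U A) = (-1) ^+ (b * #|A|) * U A.
Proof.
move=> h A; have [r _] := h A; move: r; rewrite /phase.
case: b h => h /=; last first.
  by rewrite [(false * _)%N]mul0n expr0 !mul1r; exact: conjc_real_id.
rewrite [(true * _)%N]mul1n -signr_odd; case: (odd _); last by rewrite !mul1r; exact: conjc_real_id.
move=> /conjc_real_id; rewrite rmorphM /= expr1 => e.
apply: (@mulfI _ (- ii)); first by rewrite oppr_eq0 eq_complex /= oner_eq0 andbF.
by rewrite mulN1r mulrNN -[RHS]e; congr (_ * _); rewrite -conjci.
Qed.

Lemma real_form_real p q (U : cl R (p + q)) :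
  real_form predT (@phase false (p + q)) U <-> in_real U.
Proof.
split=> h A; first by have [] := h A; rewrite mul1r => /Creal_ImP.
by split=> //; rewrite mul1r; apply/Creal_ImP.
Qed.

Lemma real_form_even_iodd p q (U : cl R (p + q)) :
  real_form predT (@phase true (p + q)) U <-> in_even_iodd U.
Proof.
split=> h A; have := h A; rewrite /phase /=.
  by case: ifP => _ [] => [/mul_i_real|]; rewrite // mul1r => /Creal_ImP.
by case: ifP => _ e; split=> //; [apply/mul_i_real|rewrite mul1r; apply/Creal_ImP].
Qed.

End Phases.

Section OddCase.
Variables (R : realType) (p q k : nat) (b t : bool).
Local Notation C := R[i].
Local Notation n := (p + q)%N.
Local Notation m := k.*2.+1.
Local Notation w := (@phase R b n).
Hypothesis nm : n = m.
Hypothesis odd_bqk : odd (b + q + k).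
Variables (sig : cl R n -> cl R n) (G : cl R n -> Prop).
Hypothesis sigE : forall U, real_form predT w U -> forall A,
  sig U A = (-1) ^+ (t * #|A| + 'C(#|A|, 2)) * U A.
Hypothesis GE : forall U, G U <-> real_form predT w U /\ clmul (sig U) U = clone R n.

(** On grade [r], [star f] contributes [(-1)^(s r + 'C(r, 2))] while [sig] has
    [(-1)^(t r + 'C(r, 2))]; the action of [f] on coefficients must make up the difference
    [(t + s) r]. *)
Lemma odd_case (f : {rmorphism C -> C}) J s : J \in unitmx ->
  (forall a, (a < m)%N ->
    star f (gen R p k a) *m J = (-1) ^+ s *: (J *m gen R p k a)) ->
  (forall U, real_form predT w U -> forall A, f (U A) = (-1) ^+ ((t + s) * #|A|) * U A) ->
  lie_iso G (fun X => star f X *m J *m X = J).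
Proof.
move=> Ju genJ fU.
have cA (A : {set 'I_n}) : cnt (ind A) m = #|A| by rewrite -nm cnt_ind.
apply: (@rep_iso R p q (gdim k) f predT w (fun A => blade (gen R p k) (ind A) m) J sig) => //.
- exact: gdim_gt0.
- by move=> A; rewrite /phase; case: ifP => _; [right|left].
- by rewrite /phase cards0 andbF.
- by move=> A B _ _; exact: phase_symd_real.
- by rewrite blade_pred0 // => i _; exact: ind0.
- move=> A B _ _; rewrite (blade_mul _ _ (@gen_anticomm R p k) (fun i _ => gen_sqr R p k i)).
  rewrite -bcoef_blade_coef -nm; congr (_ *: _); apply: eq_blade => // i im.
  by rewrite ind_symd.
- move=> A _ A0; have : (cnt (ind A) m <= m)%N by exact: cnt_le.
  rewrite leq_eqVlt => /orP[/eqP fA|lA]; last first.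
    by rewrite gen_trace ?mulr0 // lA cA andbT card_gt0.
  (* Only the pseudoscalar [i^(q + k)] remains; with its phase [i^b] the exponent is odd by
     [odd_bqk], so the value is imaginary. *)
  rewrite (@eq_blade _ _ _ (gen R p k) _ xpredT) => [|//|i im]; last exact: cnt_full fA _ im.
  rewrite gen_full mxtrace_scalar /phase -cA fA /= odd_double /=.
  have -> : (m - p = q)%N by rewrite -nm addKn.
  have -> : (if b && true then 'i%C else 1) = ('i%C : C) ^+ b by case: (b).
  by rewrite mulrnAr -exprD addnA Re_odd_power_i.
- rewrite (eq_card (B := predT)) // card_sets nm gdimE -expnD -expnSr addnn //.
- move=> U hU A; split=> //; rewrite sigE // mulrCA.
  by case: (hU A) => r _; apply: realM => //; apply: rpredX; rewrite realN real1.
- move=> U A hU _; rewrite (blade_star (@gen_anticomm R p k) (fun i im _ => genJ i im)).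
  rewrite fU // sigE // scalerA cA -mulrA [U A * _]mulrC mulrA; congr (_ * _ *: _).
  rewrite -exprM mulrA -!exprD -[LHS]signr_odd -[RHS]signr_odd !(oddD, oddM) !oddb.
  by case: (t) (odd s) (odd #|A|) (odd 'C(_, _)) => [] [] [] [].
Qed.

(** The adjoint fits when [t + b + q] is even and the transpose when [t + k] is even; as [b + q + k]
    is odd, exactly one of these holds. *)
Lemma odd_groups :
  [/\ ~~ odd (t + b + q) -> q = 0%N \/ p = 0%N -> lie_iso G (@Ugrp R (gdim k)),
      ~~ odd (t + b + q) -> (0 < q)%N -> (0 < p)%N ->
        exists2 j, k = j.+1 & lie_iso G (@Upq R (gdim j) (gdim j)),
      ~~ odd (t + k) -> ~~ odd 'C(k.+1, 2) -> lie_iso G (@OC R (gdim k))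
    & ~~ odd (t + k) -> odd 'C(k.+1, 2) ->
        exists2 j, k = j.+1 & lie_iso G (@SpC R (gdim j))].
Proof.
have mp : (m - p = q)%N by rewrite -nm addKn.
have dag : ~~ odd (t + b + q) ->
    lie_iso G (fun X => star conjc X *m Jdag R p k *m X = Jdag R p k).
  move=> o; apply: (odd_case (s := m - p)); first exact: gamma_blade_unit.
    exact: gen_dag.
  move=> U hU A; rewrite [LHS](phase_conj hU A) mp -signr_odd -[in RHS]signr_odd !oddM.
  congr (_ ^+ (_ && _) * _); move: o; rewrite !oddD !oddb.
  by case: (t) (b) (odd q) => [] [] [].
have tr : ~~ odd (t + k) -> lie_iso G (fun X => star idfun X *m Jtr R k *m X = Jtr R k).
  move=> o; apply: (odd_case (s := k)); first exact: gamma_blade_unit.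
    exact: gen_tr.
  by move=> U hU A; rewrite -signr_odd oddM (negbTE o) expr0 mul1r.
split.
- by move=> /dag h e; apply: lie_iso_U h; rewrite mp.
- move=> /dag h q0 p0; case: k nm h mp => [|j] nm' h mp'; last first.
    by exists j => //; apply: lie_iso_Upq h; rewrite mp' q0 -nm' -[X in (X < _)%N]add0n ltn_add2r.
  by have := leq_add p0 q0; rewrite nm'.
- by move=> /tr h o; exact: lie_iso_O h.
- move=> /tr h; case: k h => [|j] h o //; exists j => //; exact: lie_iso_Sp h.
Qed.

End OddCase.

(** * The even subalgebra *)

Section EvenCase.
Variables (R : realType) (p q k : nat).
Local Notation C := R[i].
Local Notation ii := ('i%C : C).
Local Notation n := (p + q)%N.
Local Notation m := k.*2.+1.
Local Notation w := (@phase R false n).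
Hypothesis nm : n = m.+1.
Hypothesis odd_kq : odd (k + q + 1).
Variable G : cl R n -> Prop.

Definition even_set : pred {set 'I_n} := fun A => ~~ odd #|A|.

Hypothesis GE : forall U,
  G U <-> real_form even_set w U /\ clmul (clrev U) U = clone R n.

(* On the even part the last generator may be represented by a scalar [c]
   commuting with the others, provided [c ^ 2] is minus its true square. *)
Definition last_scalar : C := if (m < p)%N then ii else 1.

Lemma last_scalar_sqr : last_scalar * last_scalar = - etan R p m.
Proof. by rewrite /last_scalar /etan; case: ifP => _; rewrite ?mulii ?mulr1 ?opprK. Qed.

Definition even_blade (A : {set 'I_n}) : 'M[C]_(gdim k) :=
  (if ind A m then last_scalar else 1) *: blade (gen R p k) (ind A) m.

Lemma card_split (A : {set 'I_n}) : (cnt (ind A) m + ind A m)%N = #|A|.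
Proof. exact: etrans (congr1 (cnt (ind A)) (esym nm)) (cnt_ind A). Qed.

(** As [B] is even, moving the last generator across the rest of [B] gives a sign only when [B]
    contains it too. If [A] also contains it, this sign turns [eta] into [- eta], the square of
    [last_scalar]. *)
Lemma even_blade_mul A B : even_set B -> even_blade A *m even_blade B =
  @blade_coef R p n A B *: even_blade (symd A B).
Proof.
rewrite /even_set -card_split oddD oddb => eB.
have oB : odd (cnt (ind B) m) = ind B m by case: (odd _) eB => /=; case: (ind B m).
rewrite /even_blade -bcoef_blade_coef.
have -> : bcoef (etan R p) (ind A) (ind B) n = bcoef (etan R p) (ind A) (ind B) m *
  ((-1) ^+ (ind A m * cnt (ind B) m) * (if ind A m && ind B m then etan R p m else 1)).
  exact: (congr1 (bcoef (etan R p) (ind A) (ind B)) nm).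
rewrite -scalemxAl -scalemxAr (blade_mul _ _ (@gen_anticomm R p k) (fun i _ => gen_sqr R p k i)).
rewrite (@eq_blade _ _ _ (gen R p k) _ (ind (symd A B))) // => [|i im]; last first.
  by rewrite ind_symd // nm ltnS ltnW.
rewrite !scalerA ind_symd ?nm // -signr_odd oddM oB.
have l2 := last_scalar_sqr.
congr (_ *: _); case: (ind A m) (ind B m) => [] [] /=; rewrite ?mul1r ?mulr1 //.
- by rewrite l2 expr1 mulN1r mulrC.
- by rewrite mulrC.
- by rewrite mulrC.
Qed.

Lemma even_blade_trace A : even_set A -> A != set0 -> complex.Re (\tr (even_blade A)) = 0.
Proof.
rewrite /even_set /even_blade -card_split oddD oddb mxtraceZ => eA A0.
have : (cnt (ind A) m <= m)%N by exact: cnt_le.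
rewrite leq_eqVlt => /orP[/eqP fA|lA]; last first.
  rewrite gen_trace ?mulr0 // lA andbT lt0n; apply: contra A0 => /eqP c0.
  by rewrite -cards_eq0 -card_split c0; move: eA; rewrite c0; case: (ind A m).
(* All [m] lower generators occur and [m] is odd, so the even set [A] contains the last one as
   well. *)
rewrite (@eq_blade _ _ _ (gen R p k) _ xpredT) => [|//|i im]; last exact: cnt_full fA _ im.
rewrite fA /= odd_double /= in eA; rewrite (negbNE eA) gen_full mxtrace_scalar.
have -> : last_scalar = ii ^+ (m < p) by rewrite /last_scalar; case: ifP.
rewrite mulrnAr -exprD Re_odd_power_i // !oddD oddb.
(* If [m < p] then [q = 0] and [m - p] truncates to [0]; otherwise the last generator is negative
   and [q = (m - p).+1]. *)
case: (ltnP m p) => mp.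
  have -> : (m - p = 0)%N by apply/eqP; rewrite subn_eq0 ltnW.
  have q0 : q = 0%N by move: mp nm; lia.
  by move: odd_kq; rewrite q0 addn0 addn1 /= => ->.
have qE : q = (m - p).+1 by move: mp nm; lia.
move: odd_kq; rewrite {1}qE !oddD /=; by case: (odd (m - p)) (odd k) => [] [].
Qed.

(** An even blade with the last generator has an odd number of others: reversing past them gives
    [-1], their stars give [(-1) ^+ s], and the condition on [f last_scalar] reconciles the two. *)
Lemma even_case (f : {rmorphism C -> C}) J s : J \in unitmx ->
  (forall a, (a < m)%N ->
    star f (gen R p k a) *m J = (-1) ^+ s *: (J *m gen R p k a)) ->
  (forall z : C, z \is Num.real -> f z = z) ->
  f last_scalar * (-1) ^+ s = - last_scalar ->
  lie_iso G (fun X => star f X *m J *m X = J).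
Proof.
move=> Ju genJ fr fl.
apply: (@rep_iso R p q (gdim k) f even_set w even_blade J (@clrev R n)) => //.
- exact: gdim_gt0.
- by move=> A; left.
- by rewrite /even_set cards0.
- by move=> A B; rewrite /even_set odd_card_symd => /negbTE -> /negbTE ->.
- by move=> A B _ _; exact: phase_symd_real.
- by rewrite /even_blade ind0 scale1r blade_pred0 // => i _; exact: ind0.
- by move=> A B _ IB; exact: even_blade_mul.
- by move=> A IA A0; rewrite mul1r; exact: even_blade_trace.
- rewrite (eq_card (B := [pred A : {set 'I_n} | ~~ odd #|A|])) //.
  by rewrite card_even_sets nm // gdimE -expnD -expnSr addnn.
- move=> U hU A; rewrite ffunE; have [r o] := hU A; split=> [|/o ->]; last by rewrite mulr0.
  by rewrite mulrCA; apply: realM => //; apply: rpredX; rewrite realN real1.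
- move=> U A hU IA; have [r _] := hU A; rewrite mul1r in r.
  rewrite fr // ffunE /even_blade starZ -scalemxAl -scalemxAr.
  rewrite (blade_star (@gen_anticomm R p k) (fun i im _ => genJ i im)) !scalerA.
  congr (_ *: _); rewrite [(-1) ^+ _ * U A]mulrC -!mulrA; congr (_ * _).
  move: IA; rewrite /even_set -card_split oddD oddb => IA.
  have oA : odd (cnt (ind A) m) = ind A m by case: (odd _) IA => /=; case: (ind A m).
  have -> : ((-1) ^+ s) ^+ cnt (ind A) m = if ind A m then (-1) ^+ s else 1 :> C.
    rewrite -exprM -signr_odd oddM oA; case: (ind A m); last by rewrite andbF.
    by rewrite andbT signr_odd.
  move: oA; case: (ind A m) => oA; last by rewrite rmorph1 addn0 !mul1r mulr1.
  rewrite mulrA fl addn1 binS bin1 exprD -[X in _ = _ * X * _]signr_odd oA expr1.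
  by rewrite mulrN1 !mulNr mulrC.
Qed.

(** By [odd_kq], [k] and [q] have the same parity: the adjoint fits when it is even and the
    transpose when it is odd. *)
Lemma even_groups :
  [/\ q = 0%N \/ p = 0%N -> lie_iso G (@Ugrp R (gdim k)),
      ~~ odd q -> (0 < q)%N -> (0 < p)%N ->
        exists2 j, k = j.+1 & lie_iso G (@Upq R (gdim j) (gdim j)),
      odd k -> ~~ odd 'C(k.+1, 2) -> lie_iso G (@OC R (gdim k))
    & odd k -> odd 'C(k.+1, 2) ->
        exists2 j, k = j.+1 & lie_iso G (@SpC R (gdim j))].
Proof.
have dag : q = 0%N \/ ~~ odd q ->
    lie_iso G (fun X => star conjc X *m Jdag R p k *m X = Jdag R p k).
  move=> hq; apply: (even_case (s := m - p)); first exact: gamma_blade_unit.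
  - exact: gen_dag.
  - exact: conjc_real_id.
  rewrite /last_scalar; case: ltnP => mp.
    have -> : (m - p = 0)%N by apply/eqP; rewrite subn_eq0 ltnW.
    by rewrite expr0 mulr1; exact: conjci.
  have o : odd (m - p).
    have qE : q = (m - p).+1 by move: mp nm; lia.
    by case: hq; rewrite qE //= negbK.
  by rewrite -signr_odd o rmorph1 mul1r expr1.
have tr : odd k -> lie_iso G (fun X => star idfun X *m Jtr R k *m X = Jtr R k).
  move=> o; apply: (even_case (s := k)) => //; first exact: gamma_blade_unit.
    exact: gen_tr.
  by rewrite -signr_odd o expr1 mulrN1.
split.
- move=> h; have hq : q = 0%N \/ ~~ odd q.
    case: h => [->|p0]; [by left|right].
    by move: nm; rewrite p0 add0n => ->; rewrite /= odd_double.
  by apply: lie_iso_U (dag hq); move: nm; lia.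
- move=> oq q0 p0; have h := dag (or_intror oq).
  case: k nm h => [|j] nm' h; last by exists j => //; apply: lie_iso_Upq h; move: nm' oq q0 p0; lia.
  by move: nm' oq q0 p0; lia.
- by move=> /tr h o; exact: lie_iso_O h.
- move=> /tr h; case: k h => [|j] h o //; exists j => //; exact: lie_iso_Sp h.
Qed.

End EvenCase.

(** This turns the symmetry type of [Jtr] into a condition on [n] modulo 8. *)
Lemma odd_bin2 m : odd 'C(m, 2) = odd m./2.
Proof.
elim: m => // m IH; rewrite binS bin1 oddD IH -[m.+1./2]/(uphalf m).
by rewrite uphalf_half oddD oddb addbC.
Qed.

Lemma real_form_even (R : realType) p q (U : cl R (p + q)) :
  real_form (@even_set p q) (@phase R false (p + q)) U <-> in_even U.
Proof.
split=> h A; have [r o] := h A.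
  move: r; rewrite mul1r => /Creal_ImP r; split=> // oA; apply: o.
  by rewrite /even_set oA.
by rewrite mul1r /even_set negbK; split=> //; apply/Creal_ImP.
Qed.

(** * Group types by parities of [n], [q] and their halves *)

Section Summary.
Variables (R : realType) (p q : nat).
Local Notation n := (p + q)%N.

Lemma odd_summary (b t : bool) (sig : cl R n -> cl R n) (G : cl R n -> Prop) :
  odd n -> odd (b + q + n./2) ->
  (forall U, real_form predT (@phase R b n) U -> forall A,
    sig U A = (-1) ^+ (t * #|A| + 'C(#|A|, 2)) * U A) ->
  (forall U, G U <-> real_form predT (@phase R b n) U /\ clmul (sig U) U = clone R n) ->
  [/\ ~~ odd (t + b + q) -> q = 0%N \/ p = 0%N ->
        lie_iso G (@Ugrp R (2 ^ ((n - 1) %/ 2))),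
      ~~ odd (t + b + q) -> q <> 0%N -> p <> 0%N ->
        lie_iso G (@Upq R (2 ^ ((n - 3) %/ 2)) (2 ^ ((n - 3) %/ 2))),
      ~~ odd (t + n./2) -> odd (n./2.+1)./2 -> lie_iso G (@SpC R (2 ^ ((n - 3) %/ 2)))
    & ~~ odd (t + n./2) -> ~~ odd (n./2.+1)./2 -> lie_iso G (@OC R (2 ^ ((n - 1) %/ 2)))].
Proof.
move=> on hb sigE GE; have nm : n = n./2.*2.+1 by rewrite -[LHS]odd_double_half on.
have [hU hUpq hO hSp] := odd_groups nm hb sigE GE.
have e1 : ((n - 1) %/ 2 = n./2)%N by lia.
have e3 j : n./2 = j.+1 -> ((n - 3) %/ 2 = j)%N by lia.
rewrite -!odd_bin2; split=> [h|h|h o|h].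
- by rewrite e1 -gdimE; exact: hU.
- move=> /eqP q0 /eqP p0; rewrite -!lt0n in q0 p0.
  by have [j jE] := hUpq h q0 p0; rewrite (e3 _ jE) -!gdimE.
- have [j jE] := hSp h o; by rewrite (e3 _ jE) -gdimE.
- by rewrite e1 -gdimE; exact: hO.
Qed.

Lemma even_summary (G : cl R n -> Prop) : ~~ odd n -> (0 < n)%N -> odd (n./2 + q) ->
  (forall U, G U <-> real_form (@even_set p q) (@phase R false n) U /\
    clmul (clrev U) U = clone R n) ->
  [/\ q = 0%N \/ p = 0%N -> lie_iso G (@Ugrp R (2 ^ ((n - 2) %/ 2))),
      ~~ odd q -> q <> 0%N -> p <> 0%N ->
        lie_iso G (@Upq R (2 ^ ((n - 4) %/ 2)) (2 ^ ((n - 4) %/ 2))),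
      ~~ odd n./2 -> odd (n./2)./2 -> lie_iso G (@SpC R (2 ^ ((n - 4) %/ 2)))
    & ~~ odd n./2 -> ~~ odd (n./2)./2 -> lie_iso G (@OC R (2 ^ ((n - 2) %/ 2)))].
Proof.
move=> on n0 hb GE; pose k := n./2.-1.
have kE : n./2 = k.+1 by rewrite /k; lia.
have nm : n = k.*2.+2 by rewrite -[LHS]odd_double_half (negbTE on) kE.
have hb' : odd (k + q + 1) by rewrite addn1 -addSn -kE.
have [hU hUpq hO hSp] := even_groups nm hb' GE.
have e2 : ((n - 2) %/ 2 = k)%N by lia.
have e4 j : k = j.+1 -> ((n - 4) %/ 2 = j)%N by lia.
rewrite kE -!odd_bin2 /= negbK; split=> [h|h|h o|h].
- by rewrite e2 -gdimE; exact: hU.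
- move=> /eqP q0 /eqP p0; rewrite -!lt0n in q0 p0.
  by have [j jE] := hUpq h q0 p0; rewrite (e4 _ jE) -!gdimE.
- have [j jE] := hSp h o; by rewrite (e4 _ jE) -gdimE.
- by rewrite e2 -gdimE; exact: hO.
Qed.

End Summary.

Theorem theorem2 (R : realType) (p q : nat) (hn : (1 <= p + q)%N) :
  let n := (p + q)%N in
  let k1 := (2 ^ ((n - 1) %/ 2))%N in
  let k3 := (2 ^ ((n - 3) %/ 2))%N in
  let k2 := (2 ^ ((n - 2) %/ 2))%N in
  let k4 := (2 ^ ((n - 4) %/ 2))%N in
  (* (i) *)
  ((p = q + 3 %[mod 8] \/ p = q + 7 %[mod 8]) ->
     ((q = 0%N -> lie_iso (@G23 R p q) (@Ugrp R k1)) /\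
      ((n = 3 %[mod 8] \/ n = 7 %[mod 8]) -> q <> 0%N ->
         lie_iso (@G23 R p q) (@Upq R k3 k3)) /\
      (n = 5 %[mod 8] -> lie_iso (@G23 R p q) (@SpC R k3)) /\
      (n = 1 %[mod 8] -> lie_iso (@G23 R p q) (@OC R k1)))) /\
  (* (ii) *)
  ((p = q + 3 %[mod 8] \/ p = q + 7 %[mod 8]) ->
     ((p = 0%N -> lie_iso (@G12 R p q) (@Ugrp R k1)) /\
      ((n = 1 %[mod 8] \/ n = 5 %[mod 8]) -> p <> 0%N ->
         lie_iso (@G12 R p q) (@Upq R k3 k3)) /\
      (n = 3 %[mod 8] -> lie_iso (@G12 R p q) (@SpC R k3)) /\
      (n = 7 %[mod 8] -> lie_iso (@G12 R p q) (@OC R k1)))) /\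
  (* (iii) *)
  ((p = q + 1 %[mod 8] \/ p = q + 5 %[mod 8]) ->
     ((q = 0%N -> lie_iso (@G2i1 R p q) (@Ugrp R k1)) /\
      ((n = 1 %[mod 8] \/ n = 5 %[mod 8]) -> q <> 0%N ->
         lie_iso (@G2i1 R p q) (@Upq R k3 k3)) /\
      (n = 3 %[mod 8] -> lie_iso (@G2i1 R p q) (@SpC R k3)) /\
      (n = 7 %[mod 8] -> lie_iso (@G2i1 R p q) (@OC R k1)))) /\
  (* (iv) *)
  ((p = q + 1 %[mod 8] \/ p = q + 5 %[mod 8]) ->
     ((p = 0%N -> lie_iso (@G2i3 R p q) (@Ugrp R k1)) /\
      ((n = 3 %[mod 8] \/ n = 7 %[mod 8]) -> p <> 0%N ->
         lie_iso (@G2i3 R p q) (@Upq R k3 k3)) /\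
      (n = 5 %[mod 8] -> lie_iso (@G2i3 R p q) (@SpC R k3)) /\
      (n = 1 %[mod 8] -> lie_iso (@G2i3 R p q) (@OC R k1)))) /\
  (* (v) *)
  ((p = q + 2 %[mod 8] \/ p = q + 6 %[mod 8]) ->
     (((q = 0%N \/ p = 0%N) -> lie_iso (@G2 R p q) (@Ugrp R k2)) /\
      ((n = 2 %[mod 8] \/ n = 6 %[mod 8]) -> p <> 0%N -> q <> 0%N ->
         lie_iso (@G2 R p q) (@Upq R k4 k4)) /\
      (n = 4 %[mod 8] -> lie_iso (@G2 R p q) (@SpC R k4)) /\
      (n = 0 %[mod 8] -> lie_iso (@G2 R p q) (@OC R k2)))).
Proof.
move=> n k1 k3 k2 k4; rewrite /k1 /k3 /k2 /k4 {k1 k2 k3 k4} /n {n}.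
split; [|split; [|split; [|split]]] => hpq.
(* In each part the residues modulo 8 determine the parities asked for, which [lia] derives. *)
- have [||U hU A|U|hU hUpq hSp hO] := @odd_summary R p q false false (@clrev R _) (@G23 R p q).
  + lia.
  + lia.
  + by rewrite ffunE.
  + by split=> -[/real_form_real].
  split=> [q0|]; first by apply: hU; lia.
  split=> [n37 q0|]; first by apply: hUpq; lia.
  by split=> n8; [apply: hSp|apply: hO]; lia.
- have [||U hU A|U|hU hUpq hSp hO] :=
    @odd_summary R p q false true (@clrev R _ \o @clhat R _) (@G12 R p q).
  + lia.
  + lia.
  + by rewrite !ffunE mulrA mul1n exprD [X in _ = X * _]mulrC.
  + by split=> -[/real_form_real].
  split=> [q0|]; first by apply: hU; lia.
  split=> [n37 q0|]; first by apply: hUpq; lia.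
  by split=> n8; [apply: hSp|apply: hO]; lia.
(* Here conjugation acts as the grade involution, so [cldag] is reversion combined with it and
   [t = true]. *)
- have [||U hU A|U|hU hUpq hSp hO] :=
    @odd_summary R p q true true (@cldag R _) (@G2i1 R p q).
  + lia.
  + lia.
  + by rewrite !ffunE (phase_conj hU) mulrA exprD [X in _ = X * _]mulrC.
  + by split=> -[/real_form_even_iodd].
  split=> [q0|]; first by apply: hU; lia.
  split=> [n37 q0|]; first by apply: hUpq; lia.
  by split=> n8; [apply: hSp|apply: hO]; lia.
(* The explicit grade involution cancels the one hidden in conjugation, hence [t = false]. *)
- have [||U hU A|U|hU hUpq hSp hO] :=
    @odd_summary R p q true false (@cldag R _ \o @clhat R _) (@G2i3 R p q).
  + lia.
  + lia.
  + rewrite !ffunE rmorphM rmorphXn rmorphN1 /= (phase_conj hU) mul1n.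
    by congr (_ * _); rewrite mulrA -expr2 sqrr_sign mul1r.
  + by split=> -[/real_form_even_iodd].
  split=> [q0|]; first by apply: hU; lia.
  split=> [n37 q0|]; first by apply: hUpq; lia.
  by split=> n8; [apply: hSp|apply: hO]; lia.
- have [|||U|hU hUpq hSp hO] := @even_summary R p q (@G2 R p q).
  + lia.
  + by [].
  + lia.
  + by split=> -[/real_form_even].
  split=> //; split=> [n26 p0 q0|]; first by apply: hUpq => //; lia.
  by split=> n8; [apply: hSp|apply: hO]; lia.
Qed.
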